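(* Assume that the system $\dot x(t)=Ax(t)+bf(t)$, $t\in(0,T)$, $x(0)=0$, is spectrally controllable in time $T$, and for $k\in\mathbb{N}$, $1\le i\le L_k$, let $f_k^i\in H^1_0(0,T)$ be controls with $x^{f_k^i}(T)=\phi_k^i$. Let $r$ be the response function of the system. Then the numbers $\lambda_k$ and the functions $f_k^i$ are eigenvalues and root vectors of the generalized eigenvalue problem in $L_2(0,T)$ $$\int_0^T\big[\dot r(2T-t-\tau)f(\tau)-\lambda\, r(2T-t-\tau)f(\tau)\big]\,d\tau=0,\qquad t\in(0,T),$$ that is, for every $k\in\mathbb{N}$ and $t\in(0,T)$, $$\int_0^T\big[\dot r(2T-t-\tau)f_k^1(\tau)-\lambda_k r(2T-t-\tau)f_k^1(\tau)\big]\,d\tau=0,$$ and, for $2\le i\le L_k$, $$\int_0^T\big[\dot r(2T-t-\tau)f_k^i(\tau)-\lambda_k r(2T-t-\tau)f_k^i(\tau)-r(2T-t-\tau)f_k^{i-1}(\tau)\big]\,d\tau=0.$$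
   Context: Let $H$ be a complex Hilbert space with inner product $\langle\cdot,\cdot\rangle$ (linear in the first argument), $T>0$, and let $A$ be the generator of a $C_0$-semigroup on $H$. The spectrum of $A$ is $\{\lambda_k\}_{k=1}^\infty$ (distinct complex numbers), where $\lambda_k$ is an eigenvalue of finite algebraic multiplicity $L_k\ge 1$, with one Jordan chain $\{\phi_k^i\}_{i=1}^{L_k}$ per eigenvalue: $(A-\lambda_k)\phi_k^1=0$ and $(A-\lambda_k)\phi_k^i=\phi_k^{i-1}$ for $2\le i\le L_k$. The set of all root vectors $\{\phi_k^i\}_{k\in\mathbb{N},\,1\le i\le L_k}$ is a Riesz basis of $H$. Let $\{\psi_k^i\}$ be the biorthogonal Riesz basis, consisting of root vectors of $A^*$: $\langle\phi_k^i,\psi_l^j\rangle=1$ if $(k,i)=(l,j)$ and $0$ otherwise. Let $b,d\in H$. For $f\in L_2(0,T)$ (complex valued), $x=x^f$ denotes the (mild) solution of $\dot x(t)=Ax(t)+bf(t)$, $t\in(0,T)$, $x(0)=0$. Write $b=\sum_{k}\sum_{i=1}^{L_k}b_k^i\phi_k^i$ and $d=\sum_k\sum_{i=1}^{L_k}d_k^i\psi_k^i$. The response function is $$r(t)=\sum_{k=1}^\infty e^{\lambda_k t}\sum_{j=1}^{L_k}a_k^j\frac{t^{j-1}}{(j-1)!},\qquad a_k^j=\sum_{i=j}^{L_k}b_k^i\,\overline{d_k^{\,i-j+1}},\qquad t\ge 0,$$ where the outer sum is over $k$ of the grouped terms. It is the kernel of the input-output map: $\langle x^f(t),d\rangle=\int_0^t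 r(t-\tau)f(\tau)\,d\tau$. Spectral controllability in time $T$ means: for every $k\in\mathbb{N}$ and every $i\in\{1,\dots,L_k\}$ there exists $f_k^i\in H_0^1(0,T)$ such that $x^{f_k^i}(T)=\phi_k^i$. $\dot r$ is the derivative of $r$, understood in the sense of distributions; for $f\in H^1_0(0,T)$ the integral $\int_0^T\dot r(2T-t-\tau)f(\tau)\,d\tau$ denotes the corresponding duality pairing, which equals $\int_0^T r(2T-t-\tau)\dot f(\tau)\,d\tau$. *)

(* Defs.v *)
Set Warnings "-notation-overridden,-notation-incompatible-prefix,-ambiguous-paths".
From mathcomp Require Import all_boot all_order all_algebra sesquilinear.
From mathcomp Require Import all_classical all_reals all_analysis.
From mathcomp Require Import complex.

Set Implicit Arguments.
Unset Strict Implicit.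
Unset Printing Implicit Defensive.

Import Order.TTheory GRing.Theory Num.Theory.
Import numFieldNormedType.Exports.

Local Open Scope classical_set_scope.
Local Open Scope ring_scope.
Local Open Scope complex_scope.

Notation re := complex.Re.
Notation im := complex.Im.

Section ComplexFunctions.
Variable R : realType.
Implicit Types (T t : R) (f g u phi : R -> R[i]).

Notation mu := (@lebesgue_measure R).

Definition cexp (z : R[i]) : R[i] :=
  (expR (re z))%:C * (cos (im z) +i* sin (im z)).

Definition cintegral (D : set R) f : R[i] :=
  (\int[mu]_(x in D) re (f x)) +i* (\int[mu]_(x in D) im (f x)).

Definition cderiv phi (t : R) : R[i] :=
  (derive1 (fun x => re (phi x)) t) +i* (derive1 (fun x => im (phi x)) t).

Definition sqnormL2 T f : \bar R :=
  (\int[mu]_(t in `]0%R, T[) ((re (f t)) ^+ 2 + (im (f t)) ^+ 2)%:E)%E.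

(* Elements of L_2 are represented by Borel functions. *)
Definition L2 T f : Prop :=
  [/\ measurable_fun `]0, T[ (fun t => re (f t)),
      measurable_fun `]0, T[ (fun t => im (f t))
    & (sqnormL2 T f < +oo)%E].

Definition cvgL2 T (F : nat -> R -> R[i]) f : Prop :=
  (fun n => sqnormL2 T (fun t => F n t - f t)) @ \oo --> (0 : \bar R).

Definition ae_zero T f : Prop :=
  {ae mu, forall t, 0 < t < T -> f t = 0}.

Definition smooth phi : Prop :=
  forall (n : nat) (t : R),
    derivable (derive1n n (fun x => re (phi x))) t 1 /\
    derivable (derive1n n (fun x => im (phi x))) t 1.

Definition test_function T phi : Prop :=
  smooth phi /\
  exists a b : R, [/\ 0 < a, b < T & forall t, t \notin `[a, b] -> phi t = 0].

Definition H1_deriv T f g : Prop :=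
  [/\ L2 T f, L2 T g &
   forall phi, test_function T phi ->
     cintegral `]0, T[ (fun t => f t * cderiv phi t) =
     - cintegral `]0, T[ (fun t => g t * phi t)].

(* H^1_0(0,T) is the closure of the test functions in H^1(0,T). *)
Definition H10_deriv T f g : Prop :=
  H1_deriv T f g /\
  exists F : nat -> R -> R[i],
    [/\ forall n, test_function T (F n),
        cvgL2 T F f & cvgL2 T (fun n => cderiv (F n)) g].

Definition H10 T f : Prop := exists g, H10_deriv T f g.

(* A representative of the weak derivative of f, unique almost everywhere on
   (0,T); it is 0 if f is not in H^1_0(0,T). *)
Definition wderiv T f : R -> R[i] :=
  xget (fun=> 0) [set g | H10_deriv T f g].

(* The value on f in H^1_0(0,T) of the distributional derivative of u. *)
Definition dist_deriv T u f : R[i] :=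
  - cintegral `]0, T[ (fun s => u s * wderiv T f s).

(* The integral of r(2T - t - s) f(s) over s in (0,T). *)
Definition conv_pairing T (r : R -> R[i]) (t : R) f : R[i] :=
  cintegral `]0, T[ (fun s => r (2 * T - t - s) * f s).

(* The pairing of the distribution r'(2T - t - s) in s with f: since
   d/ds (r(2T - t - s)) = - r'(2T - t - s), it is minus the derivative of
   the function s |-> r(2T - t - s). *)
Definition dconv_pairing T (r : R -> R[i]) (t : R) f : R[i] :=
  - dist_deriv T (fun s => r (2 * T - t - s)) f.

Definition pencil T (r : R -> R[i]) (z : R[i]) f (t : R) : R[i] :=
  dconv_pairing T r t f - z * conv_pairing T r t f.

(* A chain f 0, ..., f (l - 1) of root vectors of the generalized eigenvalue
   problem for the eigenvalue z. *)
Definition pencil_root_chain T (r : R -> R[i]) (z : R[i]) (l : nat)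
    (f : nat -> R -> R[i]) : Prop :=
  [/\ forall i, (i < l)%N -> ~ ae_zero T (f i),
      forall t, 0 < t < T -> pencil T r z (f 0%N) t = 0 &
      forall i, (i.+1 < l)%N -> forall t, 0 < t < T ->
        pencil T r z (f i.+1) t - conv_pairing T r t (f i) = 0].

(* All chain indices start at 0: index i stands for i + 1 in the usual
   numbering. *)
Definition response_coef (L : nat -> nat) (bc dc : nat -> nat -> R[i])
    (k j : nat) : R[i] :=
  \sum_(j <= i < L k) bc k i * Num.conj (dc k (i - j)%N).

Definition response (lam : nat -> R[i]) (L : nat -> nat)
    (bc dc : nat -> nat -> R[i]) (t : R) : R[i] :=
  limn (fun n => (\sum_(k < n) cexp (lam k * t%:C) *
    \sum_(j < L k) response_coef L bc dc k j * (t ^+ j / j`!%:R)%:C : R[i]^o)).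

End ComplexFunctions.

Section Hilbert.
Variables (R : realType) (H : completeNormedModType R[i]).
Variable ip : {dot H for Num.conj}.
Implicit Types (S : R -> H -> H) (A : set (H * H)) (f : R -> R[i]).

Notation mu := (@lebesgue_measure R).

(* The norm of H is the one induced by the inner product, which is linear in
   its first argument. *)
Definition hilbert_norm : Prop := forall x : H, `|x| ^+ 2 = ip x x.

Definition bounded_linear (V : H -> H) : Prop :=
  (forall (a : R[i]) (x y : H), V (a *: x + y) = a *: V x + V y) /\
  continuous V.

(* Only the values S t with 0 <= t are relevant. *)
Definition C0_semigroup S : Prop :=
  [/\ forall t, 0 <= t -> bounded_linear (S t),
      forall x, S 0 x = x,
      forall s t, 0 <= s -> 0 <= t -> forall x, S (s + t) x = S s (S t x) &
      forall x, (fun t => S t x) @ 0^'+ --> x].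

(* Unbounded operators are represented by their graphs. *)
Definition generator S : set (H * H) :=
  [set p | (fun h : R => (h^-1)%:C *: (S h p.1 - p.1)) @ 0^'+ --> p.2].

Definition adjoint A : set (H * H) :=
  [set p | forall x y, A (x, y) -> ip y p.1 = ip x p.2].

Definition resolvent_set A : set R[i] :=
  [set z | exists V : H -> H, bounded_linear V /\
    forall x y, A (x, z *: x - y) <-> x = V y].

Definition spectrum A : set R[i] := ~` resolvent_set A.

(* The kernel of (A - z)^n. *)
Fixpoint ker_shift A (z : R[i]) (n : nat) : set H :=
  if n is m.+1 then [set x | exists y, A (x, z *: x + y) /\ ker_shift A z m y]
  else [set 0].

Definition root_space A (z : R[i]) : set H := \bigcup_n ker_shift A z n.

Definition root_vector A (x : H) : Prop :=
  x != 0 /\ exists z, root_space A z x.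

Definition jordan_chain A (z : R[i]) (l : nat) (v : nat -> H) : Prop :=
  A (v 0%N, z *: v 0%N) /\
  forall i, (i.+1 < l)%N -> A (v i.+1, z *: v i.+1 + v i).

Definition orthonormal_basis (I : eqType) (e : I -> H) : Prop :=
  (forall p q, ip (e p) (e q) = (p == q)%:R) /\
  closure [set x | exists s : seq (R[i] * I), x = \sum_(c <- s) c.1 *: e c.2]
  = setT.

Definition riesz_basis (I : eqType) (v : I -> H) : Prop :=
  exists (V W : H -> H) (e : I -> H),
    [/\ bounded_linear V, bounded_linear W, cancel V W, cancel W V &
        orthonormal_basis e /\ forall p, v p = V (e p)].

(* Families (v k i), i < L k, are given by functions of two natural numbers
   whose values at L k <= i are irrelevant. *)
Definition root_family (L : nat -> nat) (v : nat -> nat -> H)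
    (p : {k : nat & 'I_(L k)}) : H := v (tag p) (tagged p).

Definition biorthogonal (L : nat -> nat) (v w : nat -> nat -> H) : Prop :=
  forall p q : {k : nat & 'I_(L k)},
    ip (root_family v p) (root_family w q) = (p == q)%:R.

Definition expansion (L : nat -> nat) (v : nat -> nat -> H) (x : H)
    (c : nat -> nat -> R[i]) : Prop :=
  (fun n => \sum_(k < n) \sum_(i < L k) c k i *: v k i) @ \oo --> x.

Definition simple_val (s : seq (set R * H)) (t : R) : H :=
  \sum_(p <- s) (if t \in p.1 then p.2 else 0).

Definition simple_integral (D : set R) (s : seq (set R * H)) : H :=
  \sum_(p <- s) (fine (mu (p.1 `&` D)))%:C *: p.2.

Definition simple_on (D : set R) (s : seq (set R * H)) : Prop :=
  forall p, p \in s -> measurable p.1 /\ (mu (p.1 `&` D) < +oo)%E.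

(* v is the Bochner integral of g over D. *)
Definition bochner_integral (D : set R) (g : R -> H) (v : H) : Prop :=
  exists s : nat -> seq (set R * H),
    [/\ forall n, simple_on D (s n),
        {ae mu, forall t, D t -> (fun n => simple_val (s n) t) @ \oo --> g t},
        (fun n => (\int[mu]_(t in D) (re `|g t - simple_val (s n) t|)%:E)%E)
          @ \oo --> (0 : \bar R) &
        (fun n => simple_integral D (s n)) @ \oo --> v].

Definition mild_solution S (b : H) (T : R) f (x : R -> H) : Prop :=
  forall t, 0 <= t <= T ->
    bochner_integral `]0, t[ (fun s => f s *: S (t - s) b) (x t).

(* The control f steers the system from 0 to y in time T. *)
Definition steers S (b : H) (T : R) f (y : H) : Prop :=
  exists x, mild_solution S b T f x /\ x T = y.

Definition spectrally_controllable S (b : H) (T : R) (L : nat -> nat)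
    (phi : nat -> nat -> H) : Prop :=
  forall k i, (i < L k)%N -> exists f, H10 T f /\ steers S b T f (phi k i).

End Hilbert.

(* Main.v *)
Require Import Defs.
From mathcomp Require Import all_boot all_order all_algebra sesquilinear.
From mathcomp Require Import all_classical all_reals all_analysis.
From mathcomp Require Import complex.
From mathcomp Require Import ring lra measurable_realfun.

Import Order.TTheory GRing.Theory Num.Theory.
Import numFieldNormedType.Exports.

Local Open Scope classical_set_scope.
Local Open Scope ring_scope.
Local Open Scope complex_scope.

(** Write [rho u = <S u b, d>] for the scalar orbit of [b], where [S] is the
    semigroup.  Three facts give the theorem.

    The response function is [rho].  On a Jordan chain the semigroup acts by
    [S t phi_i = exp (lam t) * sum_j t^j / j! phi_(i-j)], because after
    multiplication by [exp (- lam t)] the scalar orbits of the chain are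
    successive antiderivatives of one another ([orbit_jordan_chain], by
    [ode_chain]).  Expanding [b] and [d] and using biorthogonality turns the
    partial sums of the response series into [<S t b_n, d>], which tends to
    [rho t] ([response_orbit]).

    If [f] steers the system from 0 to [y] in time [T], then
    [int_0^T rho (T + h - s) f s ds = <S h y, d>] for [h >= 0]: apply the
    bounded functional [<S h _, d>] to the Bochner integral that defines the
    mild solution ([bochner_functional], [steered_pairing]).

    Both sides of this identity can be differentiated in [h].  On the right the
    derivative is [<S h (A y), d>].  On the left [f] vanishes at the end points,
    so that one integration by parts moves the translation from [rho] to a
    primitive of [rho], and the difference quotients of the primitive converge
    boundedly to [rho]: the derivative is [int_0^T rho (T + h - s) f' s ds]
    ([H10_difference_quotient]).  Hence the pairing with the derivative of the
    response is [<S h (A y), d>] ([steered_dpairing]).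

    With [h = T - t] and [A y = lam y + y'], the pencil applied to [f] is
    [<S (T - t) y', d>], where [y'] is 0 for the first vector of a chain and the
    preceding vector for the others.  The same pairing identity at [h = 0] and
    [d = y] shows that a control steering to [y <> 0] does not vanish almost
    everywhere.

    The identities need the orbits of [S] to be continuous and differentiable
    from both sides, which rests on the local boundedness of [S]
    ([semigroup_bounded]) and so on the uniform boundedness principle. *)

(** * The real-valued norm and the uniform boundedness principle *)

Section RealNorm.
Context {R : realType} {H : completeNormedModType R[i]}.
Implicit Types x y z : H.

(** The norm of [H] takes values in [R[i]]; estimates and real limits use its
    real part. *)
Definition rnorm x : R := re `|x|.

Lemma normE x : `|x| = (rnorm x)%:C.
Proof. by rewrite /rnorm RRe_real// ger0_real. Qed.

Lemma rnorm_ge0 x : 0 <= rnorm x.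
Proof. by rewrite -ler0c -normE. Qed.

Lemma rnormD x y : rnorm (x + y) <= rnorm x + rnorm y.
Proof. by have := ler_normD x y; rewrite !normE -rmorphD/= lecR. Qed.

Lemma rnormN x : rnorm (- x) = rnorm x.
Proof. by rewrite /rnorm normrN. Qed.

Lemma rnormB x y : rnorm (x - y) = rnorm (y - x).
Proof. by rewrite -opprB rnormN. Qed.

Lemma rnorm0 : rnorm 0 = 0.
Proof. by rewrite /rnorm normr0. Qed.

Lemma rnorm_eq0 x : rnorm x = 0 -> x = 0.
Proof. by move=> x0; apply/normr0_eq0; rewrite normE x0. Qed.

Lemma rnormZ (a : R) x : rnorm (a%:C *: x) = `|a| * rnorm x.
Proof.
apply: complexI; rewrite -normE normrZ normE rmorphM/=; congr (_ * _).
by rewrite normc_def/= expr0n addr0 sqrtr_sqr.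
Qed.

Lemma rnorm_triangle y x z : rnorm (x - z) <= rnorm (x - y) + rnorm (y - z).
Proof. by rewrite (le_trans _ (rnormD _ _))// addrA subrK. Qed.

Lemma cvg_rnormP {I} {F : set_system I} {FF : Filter F} (f : I -> H) l :
  f @ F --> l <->
  forall e : R, 0 < e -> \forall i \near F, rnorm (f i - l) < e.
Proof.
split=> [/cvgrPdistC_lt fl e e0|fl].
  have := fl e%:C; rewrite ltcR => /(_ e0).
  by apply: filterS => i; rewrite normE ltcR.
apply/cvgrPdistC_lt => e e0.
have eE : e = (re e)%:C by rewrite RRe_real// gtr0_real.
have := fl (re e); rewrite -ltcR -eE => /(_ e0).
by apply: filterS => i; rewrite normE eE ltcR.
Qed.

Lemma bounded_linear_norm (V : H -> H) : bounded_linear V ->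
  exists2 M : R, 1 <= M & forall x, rnorm (V x) <= M * rnorm x.
Proof.
move=> [linV contV].
have V0 : V 0 = 0.
  by have := linV (-1) 0 0; rewrite scaler0 addr0 scaleN1r addNr.
have VZ a x : V (a *: x) = a *: V x.
  by have := linV a x 0; rewrite !addr0 V0 addr0.
have /cvg_rnormP/(_ 1 ltr01) := contV 0.
move=> /nbhs_ballP[d /= d0 dV].
have dE : d = (re d)%:C by rewrite RRe_real// gtr0_real.
have rd0 : 0 < re d by rewrite -ltcR -dE.
exists (Num.max 1 (2 / re d)); first by rewrite le_max lexx.
move=> x; have [->|x0] := eqVneq x 0; first by rewrite V0 rnorm0 mulr0.
have nx0 : 0 < rnorm x.
  by rewrite lt_def rnorm_ge0 andbT; apply: contra_neq x0; exact: rnorm_eq0.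
pose a : R := re d / (2 * rnorm x).
have a0 : 0 < a by rewrite divr_gt0// mulr_gt0.
have : rnorm (V (a%:C *: x) - V 0) < 1.
  apply: dV; rewrite -ball_normE /ball_/= sub0r normrN normE rnormZ.
  rewrite gtr0_norm// dE ltcR /a invfM mulrA mulrVK ?unitfE ?gt_eqF//.
  by rewrite ltr_pdivrMr// ltr_pMr// ltr1n.
rewrite V0 subr0 VZ rnormZ gtr0_norm// => aV.
rewrite (@le_trans _ _ (2 / re d * rnorm x))//; last first.
  by rewrite ler_wpM2r ?rnorm_ge0// le_max lexx orbT.
rewrite (_ : 2 / re d * rnorm x = a^-1).
  by rewrite -[leRHS]mul1r ler_pdivlMr// mulrC ltW.
by rewrite /a; field; rewrite !gt_eqF.
Qed.

(** Otherwise every ball contains points that some [V n] maps arbitrarily far;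
    by continuity of that [V n] a smaller closed ball is mapped far as well.
    Nesting such balls gives a point whose images are unbounded. *)
Lemma uniform_boundedness (V : nat -> H -> H) :
  (forall n, bounded_linear (V n)) ->
  (forall x, exists K : R, forall n, rnorm (V n x) <= K) ->
  exists M : R, forall n x, rnorm (V n x) <= M * rnorm x.
Proof.
move=> linV ptw; apply: contrapT => nM.
have VB n x y : V n (x - y) = V n x - V n y.
  have [l _] := linV n; have := l (-1) y x.
  by rewrite !scaleN1r addrC => ->; rewrite addrC.
have VZ n (a : R[i]) x : V n (a *: x) = a *: V n x.
  have [l _] := linV n; have := l a x 0.
  by have := VB n 0 0; rewrite !addr0 !subrr => ->; rewrite addr0.
(* A bound on a ball would give, by linearity, a bound on the unit ball. *)
have far y (r k : R) : 0 < r ->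
    exists n z, rnorm (z - y) <= r /\ k < rnorm (V n z).
  move=> r0; apply: contrapT => nfar; apply: nM; exists (2 * `|k| / r) => n x.
  have bd z : rnorm (z - y) <= r -> rnorm (V n z) <= `|k|.
    move=> zy; rewrite (le_trans _ (ler_norm k))// leNgt; apply/negP => kz.
    by apply: nfar; exists n, z.
  have [->|x0] := eqVneq x 0.
    by rewrite -[in V n 0](subrr 0) VB subrr !rnorm0 mulr0.
  have nx0 : 0 < rnorm x.
    by rewrite lt_def rnorm_ge0 andbT; apply: contra_neq x0; exact: rnorm_eq0.
  pose a : R := r / rnorm x.
  have a0 : 0 < a by rewrite divr_gt0.
  have : rnorm (V n (a%:C *: x)) <= `|k| + `|k|.
    rewrite -[a%:C *: x](addrK y) VB (le_trans (rnormD _ _))// rnormN.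
    rewrite lerD ?bd// ?addrK ?subrr ?rnorm0 ?(ltW r0)//.
    by rewrite rnormZ gtr0_norm// divfK ?gt_eqF.
  rewrite VZ rnormZ gtr0_norm// mulrC -ler_pdivlMr// => /le_trans; apply.
  rewrite le_eqVlt; apply/orP; left; apply/eqP; rewrite /a; field.
  by rewrite !gt_eqF.
(* A state is a closed ball (centre, radius). The factor 1/2 makes the radii
   tend to 0. *)
pose good (s : H * R) k (s' : H * R) := [/\ 0 < s'.2, s'.2 <= s.2 / 2,
  forall z, rnorm (z - s'.1) <= s'.2 -> rnorm (z - s.1) <= s.2 &
  exists n, forall z, rnorm (z - s'.1) <= s'.2 -> k%:R < rnorm (V n z)].
have step (sk : (H * R) * nat) : exists s', 0 < sk.1.2 -> good sk.1 sk.2 s'.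
  case: sk => -[y r] k /=; have [r0|] := ltP 0 r; last by exists (y, r).
  have [n [z [zy kz]]] := far y (r / 2) (k%:R + 1) (divr_gt0 r0 (ltr0n _ 2)).
  have [M M1 VM] := bounded_linear_norm (V n) (linV n).
  have M0 : 0 < M := lt_le_trans ltr01 M1.
  exists (z, Num.min (r / 2) M^-1) => _; split => /=.
  - by rewrite lt_min divr_gt0// invr_gt0.
  - by rewrite ge_min lexx.
  - move=> w; rewrite le_min => /andP[wz _].
    by rewrite (le_trans (rnorm_triangle z _ _))// [leRHS](splitr r) lerD.
  - exists n => w; rewrite le_min => /andP[_ wz].
    have : rnorm (V n z) <= rnorm (V n w) + 1.
      rewrite -[V n z](subrK (V n w)) addrC (le_trans (rnormD _ _))//.
      rewrite lerD2l -VB (le_trans (VM _))// rnormB.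
      by rewrite -(@mulfV _ M) ?gt_eqF// ler_pM2l.
    by lra.
have [F HF] := choice step.
pose s := fix s k := if k is k'.+1 then F (s k', k') else (0 : H, 1 : R).
have s_gt0 k : 0 < (s k).2.
  by elim: k => [|k IH] /=; [exact: ltr01|have [] := HF (s k, k) IH].
have s_good k : good (s k) k (s k.+1) := HF (s k, k) (s_gt0 k).
have s_nest m k z : rnorm (z - (s (m + k)%N).1) <= (s (m + k)%N).2 ->
    rnorm (z - (s k).1) <= (s k).2.
  elim: m => [//|m IH] h; apply: IH.
  by have [_ _ h' _] := s_good (m + k)%N; exact: h'.
have s_small k : (s k).2 <= (k.+1%:R)^-1.
  elim: k => [|k IH]; first by rewrite invr1.
  have [_ le2 _ _] := s_good k; apply: (le_trans le2).
  have : (s k).2 / 2 <= (k.+1%:R)^-1 / 2 by rewrite ler_pM2r// invr_gt0.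
  move=> /le_trans; apply; rewrite -invfM lef_pV2 ?posrE ?mulr_gt0 ?ltr0n//.
  by rewrite -natrM ler_nat muln2 -addnn addnS addSn !ltnS leq_addr.
have s_in n k : (k <= n)%N -> rnorm ((s n).1 - (s k).1) <= (s k).2.
  move=> kn; apply: (s_nest (n - k)%N); rewrite subnK// subrr rnorm0 ltW//.
have near0 (e : R[i]) : 0 < e -> exists k : nat, forall p, (k <= p)%N ->
    rnorm ((s p).1 - (s k).1) < re e.
  move=> e0; have re0 : 0 < re e.
    by rewrite -ltcR RRe_real// gtr0_real.
  have [k _ /(_ k (leqnn k))/= ke] := near_infty_natSinv_lt (PosNum re0).
  exists k => p kp; apply: le_lt_trans (s_in _ _ kp) _.
  exact: le_lt_trans (s_small k) ke.
have : cauchy ((fun k => (s k).1) @ \oo).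
  apply: cauchy_exP => e e0; have [k kP] := near0 e e0.
  exists (s k).1; exists k => // p /= kp; rewrite -ball_normE /ball_/=.
  rewrite normE rnormB -[e]RRe_real ?gtr0_real// ltcR.
  exact: kP.
move=> /cauchy_cvg/cvg_ex[/= x sx].
have x_in k : rnorm (x - (s k).1) <= (s k).2.
  apply/ler_addgt0Pr => e e0.
  have /cvg_rnormP/(_ e e0)[N _ sN] := sx.
  pose p := maxn N k.
  rewrite (le_trans (rnorm_triangle (s p).1 _ _))// addrC lerD//.
    by rewrite s_in// leq_maxr.
  by rewrite rnormB ltW// sN//= leq_maxl.
have [K xK] := ptw x.
have [k Kk] : exists k : nat, K < k%:R.
  by exists (Num.bound `|K|); exact: le_lt_trans (ler_norm K) (archi_boundP _).
have [_ _ _ [n kV]] := s_good k.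
by have := lt_trans Kk (kV x (x_in k.+1)); rewrite ltNge xK.
Qed.

End RealNorm.

(** * Orbits of a strongly continuous semigroup *)

Section Semigroup.
Context {R : realType} {H : completeNormedModType R[i]}.
Implicit Types x y z : H.

(** Real-linear functionals: real and imaginary parts of complex ones are
    treated separately, so that real calculus applies. *)
Definition bounded_functional (m : H -> R) : Prop :=
  [/\ forall x y, m (x + y) = m x + m y,
      forall (a : R) x, m (a%:C *: x) = a * m x &
      exists2 C : R, 0 <= C & forall x, `|m x| <= C * rnorm x].

Lemma functionalB (m : H -> R) x y : bounded_functional m ->
  m (x - y) = m x - m y.
Proof.
move=> [mD mZ _]; rewrite mD; congr (_ + _).
by have := mZ (-1) y; rewrite rmorphN1 scaleN1r mulN1r.
Qed.

Lemma is_derive_littleo (f : R -> R) (t l : R) :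
  (forall e : R, 0 < e -> exists2 d : R, 0 < d &
    forall h, `|h| < d -> `|f (t + h) - f t - h * l| <= e * `|h|) ->
  is_derive t 1 f l.
Proof.
move=> fl.
have cl : h^-1 *: ((f \o shift t) (h *: 1) - f t) @[h --> 0^'] --> l.
  apply/cvgrPdistC_le => e e0; have [d d0 dP] := fl e e0.
  apply/nbhs_ballP; exists d => //= h; rewrite /ball/= sub0r normrN => hd h0.
  have hh0 : 0 < `|h| by rewrite normr_gt0.
  rewrite -(ler_pM2r hh0) -normrM (le_trans _ (dP h hd))//.
  rewrite (_ : h^-1 *: _ = h^-1 * (f (t + h) - f t)); last first.
    by rewrite /= [h%:A]mulr1 [t + h]addrC.
  by rewrite mulrBl mulrAC mulVf// mul1r [l * h]mulrC.
split; first by apply/cvg_ex; exists l.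
exact/cvg_lim.
Qed.

Variable S : R -> H -> H.
Hypothesis S_C0 : C0_semigroup S.

Lemma semigroupB t x y : 0 <= t -> S t (x - y) = S t x - S t y.
Proof.
move=> t0; have [lS _] := (let: And4 h _ _ _ := S_C0 in h) t t0.
have := lS (-1) y x.
by rewrite !scaleN1r addrC => ->; rewrite addrC.
Qed.

Lemma semigroupZ t (a : R[i]) x : 0 <= t -> S t (a *: x) = a *: S t x.
Proof.
move=> t0; have [lS _] := (let: And4 h _ _ _ := S_C0 in h) t t0.
have := lS a x 0.
have := semigroupB t 0 0 t0; rewrite !addr0 !subrr => ->.
by rewrite addr0.
Qed.

Lemma semigroupD t x y : 0 <= t -> S t (x + y) = S t x + S t y.
Proof.
move=> t0; have [lS _] := (let: And4 h _ _ _ := S_C0 in h) t t0.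
by have := lS 1 x y; rewrite !scale1r.
Qed.

Lemma semigroup_at0 t : 0 <= t -> S t 0 = 0.
Proof. by move=> t0; have := semigroupB t 0 0 t0; rewrite !subrr. Qed.

Lemma semigroup_sum t (I : Type) (r : seq I) (F : I -> H) : 0 <= t ->
  S t (\sum_(i <- r) F i) = \sum_(i <- r) S t (F i).
Proof.
move=> t0; elim: r => [|i r IH]; last by rewrite !big_cons semigroupD// IH.
by rewrite !big_nil semigroup_at0.
Qed.

Lemma semigroupM s t x : 0 <= s -> 0 <= t -> S (s + t) x = S s (S t x).
Proof. by move=> s0 t0; case: S_C0 => _ _ + _; exact. Qed.

Lemma semigroup0 x : S 0 x = x.
Proof. by case: S_C0 => _ + _ _; exact. Qed.

Lemma near_right0 (P : R -> Prop) : (\forall h \near 0^'+, P h) ->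
  exists2 d : R, 0 < d & forall h, 0 < h < d -> P h.
Proof.
move=> /nbhs_ballP[d /= d0 dP]; exists d => // h /andP[h0 hd].
by apply: dP => //; rewrite /ball/= sub0r normrN gtr0_norm.
Qed.

Lemma semigroup_near0 x (e : R) : 0 < e ->
  exists2 d : R, 0 < d & forall h, 0 <= h < d -> rnorm (S h x - x) < e.
Proof.
move=> e0; have /cvg_rnormP/(_ e e0)/near_right0[d d0 dP] :=
  (let: And4 _ _ _ h := S_C0 in h) x.
exists d => // h /andP[]; rewrite le_eqVlt => /predU1P[<- _|h0 hd].
  by rewrite semigroup0 subrr rnorm0.
by apply: dP; rewrite h0.
Qed.

(** A sequence [t_ n --> 0] along which the norms of [S (t_ n)] are unbounded
    contradicts the uniform boundedness principle, since [S (t_ n) x --> x]. *)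
Lemma semigroup_bounded_near0 : exists2 d : R, 0 < d & exists2 M : R, 1 <= M &
  forall t x, 0 <= t <= d -> rnorm (S t x) <= M * rnorm x.
Proof.
apply: contrapT => nbd.
have ex_t (n : nat) : exists t : R, 0 <= t <= n.+1%:R^-1 /\
    exists x, n%:R * rnorm x < rnorm (S t x).
  apply: contrapT => nex; apply: nbd; exists n.+1%:R^-1 => //.
  exists n.+1%:R; first by rewrite ler1n.
  move=> t x tn; rewrite leNgt; apply/negP => tx; apply: nex; exists t.
  split=> //; exists x; apply: le_lt_trans tx.
  by rewrite ler_wpM2r ?rnorm_ge0// ler_nat.
have [t_ t_P] := choice ex_t.
have t0 n : 0 <= t_ n by have [/andP[]] := t_P n.
have [||M MP] := uniform_boundedness (fun n => S (t_ n)).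
- by move=> n; have [+ _ _ _] := S_C0; apply.
- move=> x; have [d d0 dP] := semigroup_near0 x 1 ltr01.
  have [N _ /(_ N (leqnn N))/= Nd] := near_infty_natSinv_lt (PosNum d0).
  exists (rnorm x + 1 + \sum_(i < N) rnorm (S (t_ i) x)) => n.
  have s0 : 0 <= \sum_(i < N) rnorm (S (t_ i) x).
    by apply: sumr_ge0 => i _; exact: rnorm_ge0.
  have [nN|Nn] := ltnP n N.
    rewrite (bigD1 (Ordinal nN))//=.
    have : 0 <= \sum_(i < N | i != Ordinal nN) rnorm (S (t_ i) x).
      by apply: sumr_ge0 => i _; exact: rnorm_ge0.
    by have := rnorm_ge0 x; lra.
  have : rnorm (S (t_ n) x - x) < 1.
    apply: dP; rewrite t0/= (le_lt_trans _ Nd)//.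
    have [/andP[_ tn] _] := t_P n.
    by rewrite (le_trans tn)// lef_pV2 ?posrE ?ltr0n// ler_nat ltnS.
  by have := rnormD (S (t_ n) x - x) x; rewrite subrK; lra.
- pose n := Num.bound `|M|.
  have Mn : M <= n%:R.
    by rewrite ltW// (le_lt_trans (ler_norm M))// archi_boundP.
  have [_ [x]] := t_P n; apply/negP; rewrite -leNgt (le_trans (MP n x))//.
  by rewrite ler_wpM2r ?rnorm_ge0.
Qed.

Lemma semigroup_bounded (B : R) : exists2 M : R, 1 <= M &
  forall t x, 0 <= t <= B -> rnorm (S t x) <= M * rnorm x.
Proof.
have [d d0 [M M1 MP]] := semigroup_bounded_near0.
have M0 : 0 <= M by lra.
have powb n : forall t x, 0 <= t <= n%:R * d ->
    rnorm (S t x) <= M ^+ n.+1 * rnorm x.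
  elim: n => [|n IH] t x /andP[t0 tn].
    by rewrite expr1 MP// t0/= (le_trans tn)// mul0r ltW.
  have [td|dt] := leP t d.
    rewrite (le_trans (MP t x _)) ?t0// ler_wpM2r ?rnorm_ge0//.
    by rewrite exprS ler_peMr// exprn_ege1.
  rewrite -[t](subrK d) addrC semigroupM ?subr_ge0 ?(ltW d0) ?(ltW dt)//.
  rewrite (le_trans (MP _ _ _)) ?lexx ?(ltW d0)// exprS -mulrA ler_wpM2l//.
  rewrite IH// subr_ge0 (ltW dt)/= lerBlDr (le_trans tn)//.
  by rewrite -natr1 mulrDl mul1r.
pose n := Num.bound `|B / d|.
have Bn : B <= n%:R * d.
  rewrite -ler_pdivrMr// ltW// (le_lt_trans (ler_norm _))//.
  exact: archi_boundP.
exists (M ^+ n.+1); first by rewrite exprn_ege1.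
by move=> t x /andP[t0 tB]; rewrite powb// t0 (le_trans tB).
Qed.

Lemma orbit_dist (B : R) : exists2 M : R, 1 <= M & forall (s t : R) x,
  0 <= s <= B -> 0 <= t <= B ->
  rnorm (S t x - S s x) <= M * rnorm (S `|t - s| x - x).
Proof.
have [M M1 MP] := semigroup_bounded B; exists M => // s t x.
wlog st : s t / s <= t.
  move=> wl sB tB; have [st|ts] := leP s t; first exact: wl.
  by rewrite rnormB distrC wl// ltW.
move=> /andP[s0 sB] /andP[t0 tB].
rewrite ger0_norm ?subr_ge0// -[t in S t x](subrKC s).
by rewrite (semigroupM s) ?subr_ge0// -semigroupB// MP// s0.
Qed.

(** [S t] is an operator of the semigroup for [0 <= t] only; [Num.max t 0]
    extends the orbit continuously to the whole line. *)
Lemma orbit_continuous (m : H -> R) x : bounded_functional m ->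
  continuous (fun t : R => m (S (Num.max t 0) x)).
Proof.
move=> bm; have [_ _ [C C0 mC]] := bm.
move=> t; apply/cvgrPdistC_lt => e e0.
have [M M1 MP] := orbit_dist (`|t| + 1).
have M0 : 0 <= M by lra.
have e'0 : 0 < e / (C * M + 1) by rewrite divr_gt0// ltr_wpDl// mulr_ge0.
have [d d0 dP] := semigroup_near0 x _ e'0.
have d10 : 0 < Num.min d 1 by rewrite lt_min d0 ltr01.
apply/nbhs_ballP; exists (Num.min d 1) => //= s; rewrite /ball/= lt_min.
move=> /andP[tsd ts1]; rewrite -functionalB// (le_lt_trans (mC _))//.
have max_bd (u : R) : u <= `|t| + 1 -> 0 <= Num.max u 0 <= `|t| + 1.
  move=> ub; rewrite le_max lexx orbT/= ge_max ub/= addr_ge0//.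
have maxd : `|Num.max s 0 - Num.max t 0| < d.
  apply: le_lt_trans tsd; rewrite distrC.
  by case: (leP t 0) => t0; case: (leP s 0) => s0; rewrite ler_norml; 
    rewrite ?subrr; have := ler_norm (t - s); have := ler_norm (s - t);
    rewrite [`|s - t|]distrC; have := normr_ge0 (t - s); lra.
have b : rnorm (S (Num.max s 0) x - S (Num.max t 0) x)
    <= M * (e / (C * M + 1)).
  have tb : t <= `|t| + 1 by have := ler_norm t; lra.
  have sb : s <= `|t| + 1.
    by have := ler_norm t; move: ts1 (ler_norm (s - t)); rewrite distrC; lra.
  rewrite (le_trans (MP _ _ _ (max_bd _ tb) (max_bd _ sb)))// ler_wpM2l//.
  by rewrite ltW// dP// normr_ge0.
apply: (@le_lt_trans _ _ (C * (M * (e / (C * M + 1))))).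
  by rewrite ler_wpM2l.
rewrite mulrA mulrCA gtr_pMr// ltr_pdivrMr ?mul1r ?ltrDl//.
by rewrite ltr_wpDl// mulr_ge0.
Qed.

Lemma generator_near0 x y (e : R) : generator S (x, y) -> 0 < e ->
  exists2 d : R, 0 < d & forall h, 0 <= h < d ->
    rnorm (S h x - x - h%:C *: y) <= e * h.
Proof.
move=> Axy e0; have /cvg_rnormP/(_ e e0)/near_right0[d d0 dP] := Axy.
exists d => // h /andP[]; rewrite le_eqVlt => /predU1P[<- _|h0 hd].
  by rewrite semigroup0 subrr scale0r subrr rnorm0 mulr0.
have := dP h; rewrite h0 hd/= => /(_ isT) /ltW.
rewrite -(ler_pM2r h0) => /(le_trans _); apply.
rewrite mulrC -[X in X * rnorm _](gtr0_norm h0) -rnormZ scalerBr scalerA -rmorphM/=.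
by rewrite divff ?gt_eqF// scale1r.
Qed.

(** The generator is defined by a right limit. For the left derivative, write
    the increment over [t - k, t] as [S (t - k) (S k x - x)]; the error is
    controlled by the local bound of [S] and the strong continuity at [y]. *)
Lemma orbit_derive (m : H -> R) x y (t : R) : bounded_functional m ->
  generator S (x, y) -> 0 < t ->
  is_derive t 1 (fun t : R => m (S (Num.max t 0) x)) (m (S t y)).
Proof.
move=> bm Axy t0; have [mD mZ [C C0 mC]] := bm.
apply: is_derive_littleo => e e0.
have [M M1 MP] := semigroup_bounded (t + 1).
have M0 : 0 <= M by lra.
(* C bounds m, M bounds S near t, and a backward step costs two errors, hence
   2 C M; the summand 1 keeps the denominator positive. *)
have q0 : 0 < 2 * (C * M) + 1 by rewrite ltr_wpDl// !mulr_ge0.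
pose e' := e / (2 * (C * M) + 1); have e'0 : 0 < e' by rewrite divr_gt0.
have [d1 d10 d1P] := generator_near0 _ _ _ Axy e'0.
have [d2 d20 d2P] := semigroup_near0 y _ e'0.
exists (Num.min (Num.min d1 d2) (Num.min 1 t)).
  by rewrite !lt_min d10 d20 ltr01 t0.
move=> h; rewrite !lt_min => /andP[/andP[hd1 hd2] /andP[h1 ht]].
have th0 : 0 <= t + h by move: ht; rewrite ltr_norml; lra.
rewrite !max_l ?(ltW t0)// -mZ -!functionalB//.
rewrite (le_trans (mC _))//.
have -> : e * `|h| = (C * (M * (2 * e' * `|h|))) + e' * `|h|.
  by rewrite /e'; field; rewrite gt_eqF.
apply: ler_wpDr; first by rewrite mulr_ge0 ?(ltW e'0).
apply: ler_wpM2l => //.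
have [h0|h0] := leP 0 h.
  rewrite semigroupM ?(ltW t0)// -semigroupZ ?(ltW t0)//.
  rewrite -!semigroupB ?(ltW t0)//.
  have tB : 0 <= t <= t + 1 by rewrite (ltW t0) lerDl ler01.
  apply: le_trans (MP _ _ tB) _; rewrite ler_wpM2l//.
  rewrite ger0_norm//; move: hd1; rewrite ger0_norm// => hd1.
  apply: le_trans (d1P h _) _; first by rewrite h0.
  by rewrite ler_wpM2r//; lra.
have k0 : 0 <= - h by lra.
have kE : `|h| = - h by rewrite ltr0_norm.
have -> : S t x = S (t + h) (S (- h) x) by rewrite -semigroupM// addrK.
have -> : S t y = S (t + h) (S (- h) y) by rewrite -semigroupM// addrK.
rewrite -semigroupZ// -!semigroupB//.
have thB : 0 <= t + h <= t + 1 by rewrite th0/=; lra.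
apply: le_trans (MP _ _ thB) _; rewrite ler_wpM2l//.
have -> : x - S (- h) x - h%:C *: S (- h) y =
    - ((S (- h) x - x - (- h)%:C *: y) - (- h)%:C *: (S (- h) y - y)).
  rewrite rmorphN/= !scaleNr !opprK scalerBr.
  rewrite [h%:C *: S _ y - _]addrC addrA addrK !opprD opprK.
  by rewrite [- S _ x + x]addrC.
rewrite rnormN (le_trans (rnormD _ _))// rnormN rnormZ [`|- h|]ger0_norm//.
have : rnorm (S (- h) x - x - (- h)%:C *: y) <= e' * (- h).
  by apply: d1P; rewrite k0/= -kE.
have : - h * rnorm (S (- h) y - y) <= - h * e'.
  by rewrite ler_wpM2l// ltW// d2P// k0/= -kE.
by rewrite kE; lra.
Qed.
End Semigroup.

(** * Orbits of Jordan chains and the response function *)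

Section InnerProduct.
Context {R : realType} {H : completeNormedModType R[i]}.
Variable ip : {dot H for Num.conj}.
Hypothesis ip_norm : hilbert_norm ip.
Implicit Types x y z : H.

Lemma ipC x y : ip x y = Num.conj (ip y x).
Proof. by rewrite (hermitian_subproof x y) expr0 mul1r. Qed.

Lemma re_conj (z : R[i]) : re (Num.conj z) = re z.
Proof. by case: z. Qed.

Lemma rnorm_ip x : re (ip x x) = rnorm x ^+ 2.
Proof. by rewrite -ip_norm normE -rmorphXn. Qed.

(** Expanding [|x + y|^2 <= (|x| + |y|)^2] gives the Cauchy-Schwarz inequality
    for the real part. *)
Lemma re_ip_le x y : re (ip x y) <= rnorm x * rnorm y.
Proof.
have : rnorm (x + y) ^+ 2 <= (rnorm x + rnorm y) ^+ 2.
  by rewrite ler_sqr ?nnegrE ?addr_ge0 ?rnorm_ge0// rnormD.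
rewrite -rnorm_ip linearDl linearDr /= linearDr/= [ip y x]ipC.
rewrite !raddfD/= re_conj !rnorm_ip; lra.
Qed.

Lemma ipZl (a : R[i]) x y : ip (a *: x) y = a * ip x y.
Proof. by rewrite linearZl_LR. Qed.

Lemma im_ip x y : im (ip x y) = re (ip (- 'i%C *: x) y).
Proof. by rewrite ipZl; case: (ip x y) => a b /=; simpc. Qed.

Lemma rnorm_i x : rnorm (- 'i%C *: x) = rnorm x.
Proof. by rewrite /rnorm normrZ normrN normc_def/= expr0n expr1n add0r sqrtr1 mul1r. Qed.

Lemma norm_re_ip_le x y : `|re (ip x y)| <= rnorm x * rnorm y.
Proof.
rewrite ler_norml re_ip_le andbT lerNl -(rnormN x).
by rewrite (le_trans _ (re_ip_le _ _))// linearNl raddfN.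
Qed.

Lemma norm_im_ip_le x y : `|im (ip x y)| <= rnorm x * rnorm y.
Proof. by rewrite im_ip (le_trans (norm_re_ip_le _ _))// rnorm_i. Qed.

Lemma ip_functional (V : H -> H) y : bounded_linear V ->
  bounded_functional (fun x => re (ip (V x) y)) /\
  bounded_functional (fun x => im (ip (V x) y)).
Proof.
move=> bV; have [linV _] := bV; have [M M1 VM] := bounded_linear_norm V bV.
have VD x z : V (x + z) = V x + V z by have := linV 1 x z; rewrite !scale1r.
have VZ (a : R[i]) x : V (a *: x) = a *: V x.
  have := linV a x 0.
  by have := linV (-1) 0 0; rewrite !addr0 scaler0 scaleN1r addNr => ->; rewrite addr0.
have bd x : rnorm (V x) * rnorm y <= M * rnorm y * rnorm x.
  by rewrite mulrAC ler_wpM2r ?rnorm_ge0.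
have M0 : 0 <= M * rnorm y by rewrite mulr_ge0 ?rnorm_ge0//; lra.
split; split.
- by move=> x z; rewrite VD linearDl raddfD.
- by move=> a x; rewrite VZ ipZl; case: (ip _ _) => p q /=; rewrite mul0r subr0.
- by exists (M * rnorm y) => // x; rewrite (le_trans (norm_re_ip_le _ _)).
- by move=> x z; rewrite VD linearDl raddfD.
- by move=> a x; rewrite VZ ipZl; case: (ip _ _) => p q /=; rewrite mul0r addr0.
- by exists (M * rnorm y) => // x; rewrite (le_trans (norm_im_ip_le _ _)).
Qed.

Lemma bounded_linear_id : bounded_linear (idfun : H -> H).
Proof. by split=> // x; exact: cvg_id. Qed.

End InnerProduct.

Section Calculus.
Context {R : realType}.
Implicit Types t : R.

Lemma cexp0 : cexp 0 = 1 :> R[i].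
Proof. by rewrite /cexp/= expR0 cos0 sin0 mul1r. Qed.

Lemma cexpD (a b : R[i]) : cexp (a + b) = cexp a * cexp b.
Proof.
case: a => a1 a2; case: b => b1 b2; rewrite /cexp/= expRD cosD sinD.
by apply/eqP; rewrite eq_complex/=; apply/andP; split; apply/eqP; ring.
Qed.

Lemma cexp_real (z : R[i]) t :
  re (cexp (z * t%:C)) = expR (re z * t) * cos (im z * t) /\
  im (cexp (z * t%:C)) = expR (re z * t) * sin (im z * t).
Proof. by case: z => a b; rewrite /cexp/= !(mulr0, mul0r) !(subr0, add0r, addr0). Qed.

Lemma continuous_addf (f g : R -> R) : continuous f -> continuous g ->
  continuous (fun s => f s + g s).
Proof. by move=> cf cg s; apply: (@continuousD _ _ _ f g s (cf s) (cg s)). Qed.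

Lemma continuous_subf (f g : R -> R) : continuous f -> continuous g ->
  continuous (fun s => f s - g s).
Proof. by move=> cf cg s; apply: (@continuousB _ _ _ f g s (cf s) (cg s)). Qed.

Lemma continuous_mulf (f g : R -> R) : continuous f -> continuous g ->
  continuous (fun s => f s * g s).
Proof. by move=> cf cg s; apply: (@continuousM _ _ f g s (cf s) (cg s)). Qed.

Lemma is_derive_mulf (f g : R -> R) t (a b : R) :
  is_derive t 1 f a -> is_derive t 1 g b ->
  is_derive t 1 (fun s => f s * g s) (a * g t + f t * b).
Proof.
move=> fa gb; apply: (@is_derive_eq _ _ _ _ _ _ _ _ (is_deriveM fa gb)).
by rewrite addrC; congr (_ + _); exact: mulrC.
Qed.

Lemma is_derive_compf (f g : R -> R) t (a b : R) :
  is_derive (g t) 1 f a -> is_derive t 1 g b ->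
  is_derive t 1 (fun s => f (g s)) (a * b).
Proof. exact: is_derive1_comp. Qed.

Lemma is_derive_scale (c t : R) : is_derive t 1 (fun s : R => c * s) c.
Proof.
have := is_derive_mulf _ _ _ _ _ (is_derive_cst c t 1) (is_derive_id t 1).
by rewrite mul0r add0r mulr1.
Qed.

Lemma is_derive_cexp (z : R[i]) t :
  is_derive t 1 (fun s => re (cexp (z * s%:C))) (re (z * cexp (z * t%:C))) /\
  is_derive t 1 (fun s => im (cexp (z * s%:C))) (im (z * cexp (z * t%:C))).
Proof.
have -> : (fun s => re (cexp (z * s%:C))) =
    (fun s => expR (re z * s) * cos (im z * s)).
  by apply/funext => s; rewrite (cexp_real z s).1.
have -> : (fun s => im (cexp (z * s%:C))) =
    (fun s => expR (re z * s) * sin (im z * s)).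
  by apply/funext => s; rewrite (cexp_real z s).2.
have -> : re (z * cexp (z * t%:C)) =
  re z * re (cexp (z * t%:C)) - im z * im (cexp (z * t%:C)).
  by case: z => a b; case: (cexp _).
have -> : im (z * cexp (z * t%:C)) =
  re z * im (cexp (z * t%:C)) + im z * re (cexp (z * t%:C)).
  by case: z => a b; case: (cexp _).
rewrite !(cexp_real z t).1 !(cexp_real z t).2.
move: (re z) (im z) => a b.
have de := is_derive_compf _ _ _ _ _ (is_derive_expR (a * t)) (is_derive_scale a t).
have dc := is_derive_compf _ _ _ _ _ (is_derive_cos (b * t)) (is_derive_scale b t).
have ds := is_derive_compf _ _ _ _ _ (is_derive_sin (b * t)) (is_derive_scale b t).
split.
  apply: (@is_derive_eq _ _ _ _ _ _ _ _ (is_derive_mulf _ _ _ _ _ de dc)); ring.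
apply: (@is_derive_eq _ _ _ _ _ _ _ _ (is_derive_mulf _ _ _ _ _ de ds)); ring.
Qed.

(** Antiderivatives of a chain are determined by their values at 0: the
    difference with the Taylor polynomial has zero derivative. *)
Lemma ode_chain (q : nat -> R -> R) (l : nat) :
  (forall i, (i < l)%N -> continuous (q i)) ->
  (forall t, 0 < t -> (0 < l)%N -> is_derive t 1 (q 0%N) 0) ->
  (forall i t, 0 < t -> (i.+1 < l)%N -> is_derive t 1 (q i.+1) (q i t)) ->
  forall i t, (i < l)%N -> 0 <= t ->
  q i t = \sum_(j < i.+1) t ^+ j / j`!%:R * q (i - j)%N 0.
Proof.
move=> qc q0 qS; pose p i t := \sum_(j < i.+1) t ^+ j / j`!%:R * q (i - j)%N 0.
have dmono (j : nat) (c t : R) : is_derive t 1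
    (fun s : R => s ^+ j / j`!%:R * c) (j%:R * t ^+ j.-1 / j`!%:R * c).
  have := is_derive_mulf _ _ _ _ _ (is_deriveX j (is_derive_id t 1))
    (is_derive_cst (c / j`!%:R) t 1).
  rewrite (_ : (fun s : R => _) = fun s : R => s ^+ j / j`!%:R * c); last first.
    by apply/funext => s; rewrite exprfctE/= mulrA mulrAC.
  move=> h; apply: (is_derive_eq h); rewrite mulr0 addr0 [_ *: _]mulr1.
  by rewrite mulrA mulrAC.
have dp i t : is_derive t 1 (p i) (if i is i'.+1 then p i' t else 0).
  have h := is_derive_sum (fun j : 'I_i.+1 => dmono j (q (i - j)%N 0) t).
  rewrite (_ : p i = \sum_(j < i.+1) (fun s : R => s ^+ j / j`!%:R * q (i - j)%N 0)).
    apply: (is_derive_eq h).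
    rewrite big_ord_recl !mul0r add0r; case: i {h} => [|i]; first by rewrite big_ord0.
    apply: eq_bigr => j _; rewrite /= subSS factS natrM; congr (_ * _).
    have a0 : j.+1%:R != 0 :> R by rewrite pnatr_eq0.
    have b0 : j`!%:R != 0 :> R by rewrite pnatr_eq0 -lt0n fact_gt0.
    by rewrite /bump/= add1n; move: a0 b0; move: (j.+1%:R) => a a0 b0; field; rewrite a0 b0.
  by apply/funext => s; rewrite fct_sumE.
have p_at0 i : p i 0 = q i 0.
  rewrite /p big_ord_recl expr0 divr1 mul1r subn0 big1 ?addr0// => j _.
  by rewrite exprS !mul0r.
have key i (t : R) : (i < l)%N -> 0 <= t ->
    (forall s : R, 0 < s -> is_derive s 1 (q i - p i) 0) -> q i t = p i t.
  move=> il t0 d0; apply/eqP; rewrite -subr_eq0; apply/eqP.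
  have d0' x : x \in `]0, t[%R -> is_derive x 1 (q i - p i) 0.
    by rewrite in_itv/= => /andP[x0 _]; exact: d0.
  have [|c _] := MVT_segment t0 d0'; last first.
    by rewrite !addrfctE !opprfctE p_at0 subrr mul0r subr0.
  apply: continuous_subspaceT => x; apply: continuousB; first exact: qc.
  apply: differentiable_continuous; apply/derivable1_diffP.
  by have [] := dp i x.
elim=> [|i IH] t il t0; apply: key => // s s0.
  apply: (@is_derive_eq _ _ _ _ _ _ _ _ (is_deriveB (q0 s s0 il) (dp 0%N s))).
  exact: subr0.
have h := is_deriveB (qS i s s0 il) (dp i.+1 s).
by apply: (is_derive_eq h); rewrite IH ?(ltW s0) ?subrr// ltnW.
Qed.

End Calculus.

Section Response.
Context {R : realType} {H : completeNormedModType R[i]}.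
Variable ip : {dot H for Num.conj}.
Hypothesis ip_norm : hilbert_norm ip.
Variable S : R -> H -> H.
Hypothesis S_C0 : C0_semigroup S.
Implicit Types (x y z : H) (t : R).

Definition orbit_ip x y t : R[i] := ip (S (Num.max t 0) x) y.

Lemma orbit_ip_continuous x y :
  continuous (fun t => re (orbit_ip x y t)) /\
  continuous (fun t => im (orbit_ip x y t)).
Proof.
have [mr mi] := ip_functional ip ip_norm idfun y bounded_linear_id.
by split; [have := orbit_continuous S S_C0 _ x mr|
           have := orbit_continuous S S_C0 _ x mi].
Qed.

Lemma orbit_ip_derive x x' y t : generator S (x, x') -> 0 < t ->
  is_derive t 1 (fun s => re (orbit_ip x y s)) (re (orbit_ip x' y t)) /\
  is_derive t 1 (fun s => im (orbit_ip x y s)) (im (orbit_ip x' y t)).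
Proof.
move=> Ax t0; rewrite /orbit_ip (max_l (ltW t0)).
have [mr mi] := ip_functional ip ip_norm idfun y bounded_linear_id.
by split; [have := orbit_derive S S_C0 _ x x' t mr Ax t0|
           have := orbit_derive S S_C0 _ x x' t mi Ax t0].
Qed.

(** After multiplication by [exp (- lam t)], each scalar orbit of the chain has
    the preceding one as its derivative. *)
Lemma orbit_jordan_chain (lam : R[i]) (l : nat) (v : nat -> H) y i t :
  jordan_chain (generator S) lam l v -> (i < l)%N -> 0 <= t ->
  ip (S t (v i)) y = cexp (lam * t%:C) *
    \sum_(j < i.+1) (t ^+ j / j`!%:R)%:C * ip (v (i - j)%N) y.
Proof.
move=> [v0 vS] il t0.
pose w i s := orbit_ip (v i) y s.
pose q i s := cexp (- lam * s%:C) * w i s.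
have qr_ k s : re (q k s) = re (cexp (- lam * s%:C)) * re (w k s) -
    im (cexp (- lam * s%:C)) * im (w k s).
  by rewrite /q; case: (cexp _) => a b; case: (w _ _).
have qi_ k s : im (q k s) = re (cexp (- lam * s%:C)) * im (w k s) +
    im (cexp (- lam * s%:C)) * re (w k s).
  by rewrite /q; case: (cexp _) => a b; case: (w _ _).
have ec (f : R -> R) : (forall s : R, exists a : R, is_derive s 1 f a) -> continuous f.
  move=> df s; apply: differentiable_continuous; apply/derivable1_diffP.
  by have [a []] := df s.
have ecr : continuous (fun s : R => re (cexp (- lam * s%:C))).
  by apply: ec => s; eexists; exact: (is_derive_cexp (- lam) s).1.
have eci : continuous (fun s : R => im (cexp (- lam * s%:C))).
  by apply: ec => s; eexists; exact: (is_derive_cexp (- lam) s).2.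
have qrc k : continuous (fun s => re (q k s)).
  rewrite (_ : (fun _ => _) = fun s => re (cexp (- lam * s%:C)) * re (w k s) -
    im (cexp (- lam * s%:C)) * im (w k s)); last exact/funext.
  have [wr wi] := orbit_ip_continuous (v k) y.
  by apply: continuous_subf; exact: continuous_mulf.
have qic k : continuous (fun s => im (q k s)).
  rewrite (_ : (fun _ => _) = fun s => re (cexp (- lam * s%:C)) * im (w k s) +
    im (cexp (- lam * s%:C)) * re (w k s)); last exact/funext.
  have [wr wi] := orbit_ip_continuous (v k) y.
  by apply: continuous_addf; exact: continuous_mulf.
have dq k x' u (s : R) : 0 < s -> generator S (v k, lam *: v k + x') ->
    orbit_ip x' y s = u ->
    is_derive s 1 (fun s => re (q k s)) (re (cexp (- lam * s%:C) * u)) /\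
    is_derive s 1 (fun s => im (q k s)) (im (cexp (- lam * s%:C) * u)).
  move=> s0 Av xu.
  have [wr wi] := orbit_ip_derive _ _ y s Av s0.
  have [er ei] := is_derive_cexp (- lam) s.
  have wE : orbit_ip (lam *: v k + x') y s = lam * w k s + u.
    rewrite -xu /w /orbit_ip (max_l (ltW s0)) semigroupD// ?ltW//.
    by rewrite semigroupZ ?(ltW s0)// linearDl/= ipZl.
  rewrite wE in wr wi.
  have rr := is_derive_mulf _ _ _ _ _ er wr.
  have ii := is_derive_mulf _ _ _ _ _ ei wi.
  have ri := is_derive_mulf _ _ _ _ _ er wi.
  have ir := is_derive_mulf _ _ _ _ _ ei wr.
  rewrite (funext (qr_ k)) (funext (qi_ k)).
  move: rr ii ri ir; rewrite -/(w k s) {wr wi wE xu} => rr ii ri ir.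
  split.
    apply: (is_derive_eq (is_deriveB rr ii)).
    case: (cexp _) => a b; case: (w k s) => c d; case: (u) => g h.
    by case: (lam) => p r /=; ring.
  apply: (is_derive_eq (is_deriveD ri ir)).
  case: (cexp _) => a b; case: (w k s) => c d; case: (u) => g h.
  by case: (lam) => p r /=; ring.
have dq0 (s : R) : 0 < s ->
    is_derive s 1 (fun s => re (q 0%N s)) 0 /\
    is_derive s 1 (fun s => im (q 0%N s)) 0.
  move=> s0; have := dq 0%N 0 0 s s0; rewrite addr0 mulr0 => /(_ v0); apply.
  by rewrite /orbit_ip semigroup_at0 ?le_max ?lexx ?orbT// linear0l.
have dqS k (s : R) : 0 < s -> (k.+1 < l)%N ->
    is_derive s 1 (fun s => re (q k.+1 s)) (re (q k s)) /\
    is_derive s 1 (fun s => im (q k.+1 s)) (im (q k s)).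
  by move=> s0 kl; exact: dq s0 (vS k kl) erefl.
have q0E k : q k 0 = ip (v k) y.
  by rewrite /q mulr0 cexp0 mul1r /w /orbit_ip max_l// semigroup0.
have qE : q i t = \sum_(j < i.+1) (t ^+ j / j`!%:R)%:C * ip (v (i - j)%N) y.
  have Er := ode_chain (fun k s => re (q k s)) l (fun k _ => qrc k)
    (fun s s0 _ => (dq0 s s0).1) (fun k s s0 kl => (dqS k s s0 kl).1) i t il t0.
  have Ei := ode_chain (fun k s => im (q k s)) l (fun k _ => qic k)
    (fun s s0 _ => (dq0 s s0).2) (fun k s s0 kl => (dqS k s s0 kl).2) i t il t0.
  apply/eqP; rewrite eq_complex Er Ei !raddf_sum/=.
  apply/andP; split; apply/eqP; apply: eq_bigr => j _; rewrite q0E;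
    case: (ip _ _) => a b /=; ring.
rewrite -qE /q mulrA -cexpD -mulrDl subrr mul0r cexp0 mul1r.
by rewrite /w /orbit_ip max_l.
Qed.

Lemma norm_complex_le (z : R[i]) : `|z| <= (`|re z| + `|im z|)%:C.
Proof.
case: z => a b; rewrite normc_def/= lecR -ler_sqr ?nnegrE ?sqrtr_ge0 ?addr_ge0//.
rewrite sqr_sqrtr ?addr_ge0 ?sqr_ge0// sqrrD !real_normK ?num_real//.
by rewrite addrAC lerDl mulrn_wge0// mulr_ge0.
Qed.

Lemma ip_cvgl (u : nat -> H) l y : u @ \oo --> l ->
  (fun n => ip (u n) y : R[i]^o) @ \oo --> (ip l y : R[i]^o).
Proof.
move=> /cvg_rnormP ul; apply/cvgrPdistC_lt => e e0.
have eE : e = (re e)%:C by rewrite RRe_real// gtr0_real.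
have re0 : 0 < re e by rewrite -ltcR -eE.
have y0 : 0 < 2 * rnorm y + 1 by rewrite ltr_wpDl// mulr_ge0 ?rnorm_ge0.
have := ul _ (divr_gt0 re0 y0); apply: filterS => n.
rewrite ltr_pdivlMr// => ule.
rewrite -linearBl/= (le_lt_trans (norm_complex_le _))// eE ltcR.
apply: le_lt_trans ule.
have := norm_re_ip_le ip ip_norm (u n - l) y.
have := norm_im_ip_le ip ip_norm (u n - l) y.
by have := rnorm_ge0 (u n - l); lra.
Qed.

Lemma ip_suml (I : Type) (r : seq I) (F : I -> H) y :
  ip (\sum_(i <- r) F i) y = \sum_(i <- r) ip (F i) y.
Proof.
elim: r => [|i r IH]; first by rewrite !big_nil linear0l.
by rewrite !big_cons linearDl/= IH.
Qed.

Lemma expansion_coef (L : nat -> nat) (phi psi : nat -> nat -> H) d dc k i :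
  biorthogonal ip L phi psi -> expansion L psi d dc -> (i < L k)%N ->
  ip (phi k i) d = Num.conj (dc k i).
Proof.
move=> bi dE il; rewrite ipC; congr Num.conj.
have /cvg_lim <- // := ip_cvgl _ _ (phi k i) dE.
apply: lim_near_cst => //; exists k.+1 => // n /= kn.
rewrite ip_suml (bigD1 (Ordinal kn))//= ip_suml (bigD1 (Ordinal il))//=.
have psi_phi k' (i' : 'I_(L k')) : ip (psi k' i') (phi k i) =
    (Tagged (fun k => 'I_(L k)) (Ordinal il) == Tagged (fun k => 'I_(L k)) i')%:R.
  have := bi (Tagged (fun k => 'I_(L k)) (Ordinal il)) (Tagged _ i').
  by rewrite /root_family/= ipC => /(congr1 Num.conj); rewrite conjCK rmorph_nat.
rewrite ipZl (psi_phi k (Ordinal il)) eqxx mulr1 !big1 ?addr0//.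
- move=> k' kk'; rewrite ip_suml big1// => i' _; rewrite ipZl psi_phi.
  case: eqP => [[/esym ek]|]; last by rewrite mulr0.
  by case/eqP: kk'; apply: val_inj.
- move=> i' ii'; rewrite ipZl psi_phi eq_Tagged/= eq_sym (negbTE ii') mulr0 //.
Qed.

(** The [n]-th partial sum of the response is [<S t b_n, d>], where [b_n] is the
    [n]-th partial sum of the expansion of [b]. *)
Lemma response_orbit (lam : nat -> R[i]) (L : nat -> nat)
  (phi psi : nat -> nat -> H) (b d : H) (bc dc : nat -> nat -> R[i]) t :
  (forall k, jordan_chain (generator S) (lam k) (L k) (phi k)) ->
  biorthogonal ip L phi psi ->
  expansion L phi b bc -> expansion L psi d dc -> 0 <= t ->
  response lam L bc dc t = ip (S t b) d.
Proof.
move=> chain bi bE dE t0.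
have [+ _ _ _] := S_C0 => /(_ t t0) [_ contS].
have Sb : (fun n => S t (\sum_(k < n) \sum_(i < L k) bc k i *: phi k i))
    @ \oo --> S t b.
  exact: (cvg_comp _ _ bE (contS b)).
apply: (@cvg_lim R[i]^o) => //.
apply: cvg_trans (ip_cvgl _ _ d Sb); apply: near_eq_cvg; apply: nearW => n.
apply/esym.
rewrite semigroup_sum// ip_suml; apply: eq_bigr => k _.
rewrite semigroup_sum// ip_suml.
pose T j : R[i] := (t ^+ j / j`!%:R)%:C.
transitivity (cexp (lam k * t%:C) * \sum_(i < L k) \sum_(j < L k | (j <= i)%N)
    bc k i * (T j * Num.conj (dc k (i - j)%N))).
  congr (_ * _); rewrite [RHS](exchange_big_dep xpredT)//=; apply: eq_bigr => j _.
  rewrite /response_coef big_geq_mkord mulr_suml/=; apply: eq_bigr => i _.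
  by rewrite -mulrA; congr (_ * _); rewrite mulrC.
rewrite mulr_sumr; apply: eq_bigr => i _.
rewrite semigroupZ// ipZl (orbit_jordan_chain _ _ _ _ _ _ (chain k))//.
rewrite mulrCA; congr (_ * _); rewrite -mulr_sumr; congr (_ * _).
rewrite (big_ord_widen_cond _ xpredT (fun j => T j * ip (phi k (i - j)%N) d) (ltn_ord i)).
apply: eq_big => [j|j ji]; first by rewrite ltnS.
rewrite (expansion_coef _ _ _ _ _ _ _ bi dE)//.
by rewrite (leq_ltn_trans (leq_subr _ _)).
Qed.

End Response.

(** * Functionals and Bochner integrals *)

Section RealIntegrable.
Context {R : realType}.
Notation mu := (@lebesgue_measure R).
Implicit Types (D : set R) (f g : R -> R).

Definition Rintegrable D f : Prop := mu.-integrable D (EFin \o f).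

Lemma Rintegrable_ext D f g : measurable D -> {in D, f =1 g} ->
  Rintegrable D f -> Rintegrable D g.
Proof. by move=> mD fg; apply: eq_integrable => // t tD /=; rewrite fg. Qed.

Lemma RintegrableD D f g : measurable D -> Rintegrable D f ->
  Rintegrable D g -> Rintegrable D (fun t => f t + g t).
Proof. by move=> mD fi gi; exact: (@integrableD _ _ _ mu D mD _ _ fi gi). Qed.

Lemma RintegrableB D f g : measurable D -> Rintegrable D f ->
  Rintegrable D g -> Rintegrable D (fun t => f t - g t).
Proof. by move=> mD fi gi; exact: (@integrableB _ _ _ mu D mD _ _ fi gi). Qed.

Lemma RintegrableZ D (c : R) f : measurable D -> Rintegrable D f ->
  Rintegrable D (fun t => c * f t).
Proof. by move=> mD fi; exact: (@integrableZl _ _ _ mu D mD c _ fi). Qed.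

Lemma Rintegrable_norm D f : Rintegrable D f ->
  Rintegrable D (fun t => `|f t|).
Proof. by move=> fi; exact: (@integrable_norm _ _ _ mu D f fi). Qed.

Lemma le_norm_Rintegral D f : measurable D -> Rintegrable D f ->
  `|\int[mu]_(t in D) f t| <= \int[mu]_(t in D) `|f t|.
Proof. by move=> mD fi; exact: (@le_normr_Rintegral _ _ _ mu D f mD fi). Qed.

End RealIntegrable.

Section Bochner.
Context {R : realType} {H : completeNormedModType R[i]}.
Notation mu := (@lebesgue_measure R).
Implicit Types (D : set R) (g : R -> H) (v : H) (m : H -> R).

(** The integral of a nonnegative function is the supremum over the simple
    functions below it, hence monotone; norms of vector-valued functions can be
    compared directly. *)
Lemma ge0_le_integral_any D (f1 f2 : R -> \bar R) :
  (forall t, D t -> (0 <= f1 t)%E) -> (forall t, D t -> (f1 t <= f2 t)%E) ->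
  (\int[mu]_(t in D) f1 t <= \int[mu]_(t in D) f2 t)%E.
Proof.
move=> f10 f12; rewrite integral_mkcond [leRHS]integral_mkcond.
have h12 t : ((f1 \_ D) t <= (f2 \_ D) t)%E by exact: lee_restrict.
have h10 t : (0 <= (f1 \_ D) t)%E by exact: erestrict_ge0.
rewrite !ge0_integralTE//; last by move=> t; exact: le_trans (h12 t).
apply: le_ereal_sup => _ [h /= hf1 <-]; exists h => //= t.
exact: le_trans (hf1 t) (h12 t).
Qed.

Lemma functional_simple m D (s : seq (set R * H)) :
  bounded_functional m -> measurable D -> simple_on D s ->
  Rintegrable D (fun t => m (simple_val s t)) /\
  \int[mu]_(t in D) m (simple_val s t) = m (simple_integral D s).
Proof.
move=> bm mD; have [mDd mZ _] := bm.
have m0 : m 0 = 0 by rewrite -(subrr 0) functionalB// subrr.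
elim: s => [|p s IH] sD.
  have z t : m (simple_val (Nil (set R * H)) t) = 0.
    by rewrite /simple_val big_nil m0.
  rewrite /simple_integral big_nil m0; split.
    by apply: (Rintegrable_ext D (cst 0)) => //; exact: integrable0.
  by under eq_Rintegral do rewrite z; rewrite /Rintegral integral0.
have [|IHi IHe] := IH; first by move=> q qs; apply: sD; rewrite inE qs orbT.
have [mp mup] := sD p (mem_head p s).
have E t : m (simple_val (p :: s) t) = m p.2 * \1_p.1 t + m (simple_val s t).
  rewrite /simple_val big_cons mDd indicE; congr (_ + _).
  by case: ifP => _; rewrite ?mulr1 ?mulr0 ?m0.
have ii : Rintegrable D (\1_p.1).
  apply/integrableP; split.
    by apply/measurable_EFinP; exact: measurable_indic.
  under eq_integral do rewrite /= ger0_norm//.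
  by rewrite integral_indic.
have iZ := RintegrableZ D (m p.2) _ mD ii.
split.
  apply: (Rintegrable_ext D (fun t => m p.2 * \1_p.1 t + m (simple_val s t))) => //.
  exact: RintegrableD.
under eq_Rintegral do rewrite E.
rewrite RintegralD// IHe /simple_integral big_cons mDd mZ; congr (_ + _).
rewrite RintegralZl// mulrC; congr (_ * _).
by rewrite /Rintegral integral_indic.
Qed.

(** Both sides are limits of the corresponding quantities for the approximating
    simple functions, the left one because the integral of
    [|m (g t) - m (s_n t)|] is at most [C] times that of [|g t - s_n t|]. *)
Lemma bochner_functional m D g v :
  bounded_functional m -> measurable D -> bochner_integral D g v ->
  Rintegrable D (fun t => m (g t)) ->
  \int[mu]_(t in D) m (g t) = m v.
Proof.
move=> bm mD [s [sD _ sg sv]] ig; have [_ _ [C C0 mC]] := bm.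
apply/eqP; rewrite -subr_eq0 -normr_le0; apply/ler_addgt0Pr => e e0.
rewrite add0r.
have C1 : 0 < C + 1 by rewrite ltr_wpDl.
have e'0 : 0 < e / (2 * (C + 1)) by rewrite divr_gt0// mulr_gt0.
move: sg => /fine_cvgP[sfin /cvgrPdistC_lt/(_ _ e'0) sg].
move: sv => /cvg_rnormP/(_ _ e'0) sv.
pose I n : \bar R := (\int[mu]_(t in D) (re `|g t - simple_val (s n) t|)%:E)%E.
have [n [[nfin ng] nv]] : exists n,
    (I n \is a fin_num /\ `|fine (I n) - 0| < e / (2 * (C + 1))) /\
    rnorm (simple_integral D (s n) - v) < e / (2 * (C + 1)).
  have [N _ /(_ N (leqnn N)) h] := filterI (filterI sfin sg) sv.
  by exists N.
have [si sE] := functional_simple m D (s n) bm mD (sD n).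
have -> : e = (C + 1) * (e / (2 * (C + 1))) + (C + 1) * (e / (2 * (C + 1))).
  by field; rewrite gt_eqF.
rewrite -(subrK (m (simple_integral D (s n))) (\int[mu]_(t in D) m (g t))) -addrA.
rewrite (le_trans (ler_normD _ _))// lerD//; last first.
  rewrite -functionalB// (le_trans (mC _))// ler_pM// ?rnorm_ge0//.
    by rewrite lerDl.
  exact: ltW.
rewrite -sE -RintegralB//.
have iB := RintegrableB _ _ _ mD ig si.
rewrite (le_trans (le_norm_Rintegral _ _ mD iB))// mulrC -ler_pdivrMr//.
apply: le_trans (ltW ng); rewrite subr0 ger0_norm; last first.
  by rewrite fine_ge0// integral_ge0// => t _; rewrite lee_fin rnorm_ge0.
have iN : Rintegrable D (fun t => `|m (g t) - m (simple_val (s n) t)|).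
  exact: Rintegrable_norm iB.
rewrite mulrC -RintegralZl//.
rewrite /Rintegral fine_le//.
  by apply: integrable_fin_num => //; exact: RintegrableZ.
apply: ge0_le_integral_any => t _.
  by rewrite lee_fin mulr_ge0// invr_ge0 ltW.
rewrite lee_fin mulrC ler_pdivrMr// -functionalB// (le_trans (mC _))// mulrC.
by rewrite ler_wpM2l ?rnorm_ge0// lerDl.
Qed.
End Bochner.

(** * Mean square convergence on a bounded interval *)

Section RealConvolution.
Context {R : realType}.
Notation mu := (@lebesgue_measure R).
Variable T : R.
Hypothesis T_gt0 : 0 < T.
Implicit Types (f g u p phi P : R -> R).

Local Notation D := (`]0, T[%classic : set R).

Definition cont0T phi := forall s, 0 <= s <= T -> {for s, continuous phi}.

Let mD : measurable D.
Proof. exact: measurable_itv. Qed.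

Lemma cont0T_within phi : cont0T phi -> {within `[0, T], continuous phi}.
Proof.
move=> c; apply: continuous_in_subspaceT => s; rewrite inE/= in_itv/=.
exact: c.
Qed.

Lemma cont0T_continuous phi : continuous phi -> cont0T phi.
Proof. by move=> c s _; exact: c. Qed.

Lemma cont0T_derivable phi (dphi : R -> R) :
  (forall s, 0 <= s <= T -> is_derive s 1 phi (dphi s)) -> cont0T phi.
Proof.
move=> d s sT; apply: differentiable_continuous; apply/derivable1_diffP.
by have [] := d s sT.
Qed.

Lemma cont0T_bounded phi : cont0T phi ->
  exists2 C : R, 0 <= C & forall s, 0 <= s <= T -> `|phi s| <= C.
Proof.
move=> c.
have cn : {within `[0, T], continuous (fun s => `|phi s|)}.
  apply: cont0T_within => s sT; apply: (@cvg_norm _ _ _ _ _ phi).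
  exact: c.
have [x _ xmax] := EVT_max (ltW T_gt0) cn.
by exists `|phi x| => // s sT; apply: xmax; rewrite in_itv.
Qed.

Lemma cont0T_measurable phi : cont0T phi -> measurable_fun D phi.
Proof.
move=> c; apply: subspace_continuous_measurable_fun => //.
apply: continuous_in_subspaceT => s; rewrite inE/= in_itv/= => /andP[s0 sT].
by apply: c; rewrite !ltW.
Qed.

Lemma mem_itv0T s : D s -> 0 <= s <= T.
Proof. by rewrite /= in_itv/= => /andP[s0 sT]; rewrite !ltW. Qed.

Lemma lebesgue_itv0T : mu D = T%:E.
Proof. by rewrite lebesgue_measure_itv/= lte_fin T_gt0 oppr0 adde0. Qed.

Lemma Rintegrable_cst (c : R) : Rintegrable D (cst c).
Proof.
apply/integrableP; split; first exact/measurable_EFinP/measurable_cst.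
rewrite (_ : (\int[mu]_(x in D) _)%E = (\int[mu]_(x in D) cst `|c|%:E x)%E)//.
by rewrite integral_cst// [X in (_ * X)%E]lebesgue_itv0T ltry.
Qed.

Lemma Rintegrable_mul phi f : cont0T phi -> Rintegrable D f ->
  Rintegrable D (fun s => phi s * f s).
Proof.
move=> c fi; have [C C0 cC] := cont0T_bounded phi c.
apply: (@le_integrable _ _ _ mu D mD _ (EFin \o (fun s => C * f s))).
- apply/measurable_EFinP; apply: measurable_funM.
    exact: cont0T_measurable.
  by move/integrableP : fi => [/measurable_EFinP].
- move=> s /mem_itv0T sT /=; rewrite lee_fin !normrM ler_wpM2r// (ger0_norm C0).
  exact: cC.
- exact: RintegrableZ.
Qed.

Lemma Rintegrable_cont phi : cont0T phi -> Rintegrable D phi.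
Proof.
move=> c; have := Rintegrable_mul phi (cst 1) c (Rintegrable_cst 1).
by apply: Rintegrable_ext => // s _; rewrite mulr1.
Qed.

(** [|f| <= 1 + f^2], and constants are integrable on a bounded interval. *)
Lemma Rintegrable_sqr f : measurable_fun D f ->
  Rintegrable D (fun s => f s ^+ 2) -> Rintegrable D f.
Proof.
move=> mf f2.
apply: (@le_integrable _ _ _ mu D mD _ (EFin \o (fun s => 1 + f s ^+ 2))).
- exact/measurable_EFinP.
- move=> s _ /=; rewrite lee_fin [leRHS]ger0_norm ?addr_ge0 ?sqr_ge0//.
  have := sqr_ge0 (`|f s| - 1); rewrite -(real_normK (num_real (f s))).
  by have := normr_ge0 (f s); nra.
- by apply: RintegrableD => //; exact: Rintegrable_cst.
Qed.

(** Since [|u| <= a + u^2 / a] for every [a > 0] and the interval is bounded,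
    mean square convergence gives convergence in the mean. *)
Lemma cvg_integral_L2 phi f (F : nat -> R -> R) (J : nat -> \bar R) :
  cont0T phi -> Rintegrable D f -> (forall n, Rintegrable D (F n)) ->
  (forall n, (\int[mu]_(s in D) ((F n s - f s) ^+ 2)%:E <= J n)%E) ->
  J @ \oo --> (0%R%:E : \bar R) ->
  \int[mu]_(s in D) (phi s * F n s) @[n --> \oo] --> \int[mu]_(s in D) (phi s * f s).
Proof.
move=> cphi fi Fi FJ J0; have [C C0 cC] := cont0T_bounded phi cphi.
apply/cvgrPdistC_lt => e e0.
(* C bounds phi, T is the length of the interval: the bound
   C (a T + b / a) is below e for these values of a and b. *)
pose a := e / (2 * (C + 1) * (T + 1)).
have a0 : 0 < a by rewrite divr_gt0// !mulr_gt0// ltr_wpDl// ltW.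
pose b := a * (e / (2 * (C + 1))).
have b0 : 0 < b by rewrite mulr_gt0// divr_gt0// mulr_gt0// ltr_wpDl.
have /fine_cvgP[Jfin /cvgrPdistC_lt/(_ _ b0) Jb] := J0.
near=> n.
have Jn : (J n < b%:E)%E.
  have fn : J n \is a fin_num by near: n.
  rewrite -(fineK fn) lte_fin (le_lt_trans (ler_norm _))//.
  by rewrite -[fine _]subr0; near: n.
pose u s := F n s - f s.
have ui : Rintegrable D u by apply: RintegrableB.
have mu_ : measurable_fun D u by move/integrableP : ui => [/measurable_EFinP].
have u2 : (\int[mu]_(s in D) (u s ^+ 2)%:E < b%:E)%E.
  exact: le_lt_trans (FJ n) Jn.
have u2i : Rintegrable D (fun s => u s ^+ 2).
  apply/integrableP; split; first exact/measurable_EFinP/measurable_funX.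
  under eq_integral do rewrite /= ger0_norm ?sqr_ge0//.
  by rewrite (lt_trans u2)// ltry.
have u2b : \int[mu]_(s in D) (u s ^+ 2) < b.
  rewrite -lte_fin /Rintegral fineK//.
  exact: (@integrable_fin_num _ _ _ mu D mD _ u2i).
rewrite -RintegralB//; [|exact: Rintegrable_mul|exact: Rintegrable_mul].
under eq_Rintegral do rewrite -mulrBr -/(u _).
rewrite (le_lt_trans (le_norm_Rintegral _ _ mD _))//.
  exact: Rintegrable_mul.
apply: (@le_lt_trans _ _ (\int[mu]_(s in D) (C * (a + a^-1 * u s ^+ 2)))).
  apply: le_Rintegral => //.
  - by apply: Rintegrable_norm; exact: Rintegrable_mul.
  - apply: RintegrableZ => //; apply: RintegrableD => //.
      exact: Rintegrable_cst.
    exact: RintegrableZ.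
  move=> s /mem_itv0T sT; rewrite normrM ler_pM// ?cC//.
  rewrite -(ler_pM2l a0) mulrDr mulVKf ?gt_eqF//.
  rewrite -(real_normK (num_real (u s))).
  have := sqr_ge0 (`|u s| - a); have := sqr_ge0 `|u s|; have := sqr_ge0 a.
  by have := normr_ge0 (u s); nra.
rewrite RintegralZl//; last first.
  apply: RintegrableD => //; first exact: Rintegrable_cst.
  exact: RintegrableZ.
rewrite RintegralD//; [|exact: Rintegrable_cst|exact: RintegrableZ].
rewrite Rintegral_cst// RintegralZl// [X in a * fine X]lebesgue_itv0T/=.
apply: (@le_lt_trans _ _ (C * (a * T + a^-1 * b))).
  by rewrite ler_wpM2l// lerD2l ler_pM2l ?invr_gt0// ltW.
rewrite /b mulKf ?gt_eqF// /a.
have C1 : 0 < C + 1 by rewrite ltr_wpDl.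
have T1 : 0 < T + 1 by rewrite addr_gt0.
rewrite (_ : C * _ = e * (C / (C + 1) * ((T / (T + 1) + 1) / 2))); last first.
  by field; rewrite !gt_eqF.
rewrite gtr_pMr//.
have x1 : C / (C + 1) < 1 by rewrite ltr_pdivrMr// mul1r ltrDl ltr01.
have x0 : 0 <= C / (C + 1) by rewrite divr_ge0// ltW.
have y1 : T / (T + 1) < 1 by rewrite ltr_pdivrMr// mul1r ltrDl ltr01.
have y0 : 0 <= T / (T + 1) by rewrite divr_ge0 ?ltW//.
by nra.
Unshelve. all: by end_near. Qed.

End RealConvolution.

(** * Differentiating a convolution through a primitive of its kernel *)

Section DifferenceQuotient.
Context {R : realType}.
Notation mu := (@lebesgue_measure R).
Variable T : R.
Hypothesis T_gt0 : 0 < T.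
Implicit Types (f g p phi : R -> R) (u : R).

Local Notation D := (`]0, T[%classic : set R).

Let mD : measurable D.
Proof. exact: measurable_itv. Qed.

Definition primitive p (u : R) : R := \int[mu]_(x in `[0, u]) p x.

Lemma is_derive_primitive p u : continuous p -> 0 < u ->
  is_derive u 1 (primitive p) (p u).
Proof.
move=> cp u0.
have pi : mu.-integrable `[0, u + 1] (EFin \o p).
  apply: continuous_compact_integrable; first exact: segment_compact.
  exact: continuous_subspaceT.
have uu : u < u + 1 by rewrite ltrDl.
have [d1 d2] := continuous_FTC1_closed uu pi u0 (cp u).
by split=> //; rewrite -derive1E.
Qed.

Lemma is_derive_reflect p (dp c s : R) : is_derive (c - s) 1 p dp ->
  is_derive s 1 (fun x => p (c - x)) (- dp).
Proof.
move=> h.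
have hs : is_derive s 1 (fun x : R => c - x) (0 - 1).
  exact: (is_deriveB (is_derive_cst c s 1) (is_derive_id s 1)).
have := is_derive_compf p _ s _ _ h hs.
by rewrite sub0r mulrN1.
Qed.

Lemma continuous_reflect p (c : R) : continuous p ->
  continuous (fun s => p (c - s)).
Proof.
move=> cp s; apply: (@continuous_comp _ _ _ (fun s : R => c - s) p).
  by apply: continuousB; [exact: cst_continuous|exact: cvg_id].
exact: cp.
Qed.

Lemma cont0T_primitive p (c : R) : continuous p -> T < c ->
  cont0T T (fun s => primitive p (c - s)).
Proof.
move=> cp Tc; apply: (cont0T_derivable T _ (fun s => - p (c - s))).
move=> s /andP[_ sT]; apply: is_derive_reflect; apply: is_derive_primitive => //.
by rewrite subr_gt0 (le_lt_trans sT).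
Qed.

(** The boundary terms vanish with [F]; the sign comes from the reflection
    [s |-> c - s]. The hypothesis [T < c] keeps [c - s] positive, where
    [primitive p] has derivative [p]. *)
Lemma primitive_by_parts p (F dF : R -> R) (c : R) : continuous p -> T < c ->
  (forall s : R, is_derive s 1 F (dF s)) -> continuous dF -> F 0 = 0 -> F T = 0 ->
  \int[mu]_(s in D) (p (c - s) * F s) =
  \int[mu]_(s in D) (primitive p (c - s) * dF s).
Proof.
move=> cp Tc FdF cdF F0 FT.
have cF : continuous F.
  move=> s; apply: differentiable_continuous; apply/derivable1_diffP.
  by have [] := FdF s.
have cP := cont0T_primitive p c cp Tc.
have cpr := cont0T_continuous T _ (continuous_reflect p c cp).
have i1 : Rintegrable D (fun s => p (c - s) * F s).
  by apply: Rintegrable_mul => //; apply: Rintegrable_cont => //; exact: cont0T_continuous.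
have i2 : Rintegrable D (fun s => primitive p (c - s) * dF s).
  by apply: Rintegrable_mul => //; apply: Rintegrable_cont => //; exact: cont0T_continuous.
pose k s := primitive p (c - s) * dF s - p (c - s) * F s.
pose K s := primitive p (c - s) * F s.
have dK (s : R) : 0 <= s <= T -> is_derive s 1 K (k s).
  move=> /andP[s0 sT].
  have h : is_derive s 1 (fun x => primitive p (c - x)) (- p (c - s)).
    apply: is_derive_reflect; apply: is_derive_primitive => //.
    by rewrite subr_gt0 (le_lt_trans sT).
  apply: (is_derive_eq (is_derive_mulf _ _ _ _ _ h (FdF s))).
  by rewrite /k mulNr addrC.
have cK : cont0T T K := cont0T_derivable T _ k dK.
have ck : cont0T T k.
  move=> s sT; apply: continuousB; apply: continuousM.
  - exact: cP.
  - exact: cdF.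
  - exact: cpr.
  - exact: cF.
have in0T s : s \in `]0, T[%R -> 0 <= s <= T.
  by rewrite in_itv/= => /andP[s0 sT]; rewrite !ltW.
have := @continuous_FTC2 R k K 0 T T_gt0 (cont0T_within T _ ck).
have ik : Rintegrable D k := Rintegrable_cont T T_gt0 k ck.
have -> : (\int[mu]_(x in `[0%R, T]) (k x)%:E = \int[mu]_(x in D) (k x)%:E)%E.
  rewrite -integral_itv_bndo_bndc; last first.
    apply/measurable_EFinP; apply: subspace_continuous_measurable_fun => //.
    apply: continuous_in_subspaceT => s; rewrite inE/= in_itv/= => /andP[s0 sT].
    by apply: ck; rewrite s0 ltW.
  rewrite -integral_itv_obnd_cbnd//; apply/measurable_EFinP.
  exact: cont0T_measurable.
rewrite /K F0 FT !mulr0 subee// => h.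
have {}h : (\int[mu]_(x in D) (k x)%:E = 0)%E.
  apply: h; last first.
    by move=> s /in0T sT; rewrite derive1E; have [_ ->] := dK s sT.
  split.
  - by move=> s /in0T sT; have [] := dK s sT.
  - by apply: cvg_at_right_filter; apply: cK; rewrite lexx ltW.
  - by apply: cvg_at_left_filter; apply: cK; rewrite lexx ltW.
apply/eqP; rewrite eq_sym -subr_eq0 -RintegralB//.
by rewrite /Rintegral h.
Qed.

(** The weak form of [primitive_by_parts], for mean square limits of functions
    vanishing at the end points. *)
Lemma primitive_by_parts_weak p f g (F dF : nat -> R -> R) (J J' : nat -> \bar R)
    (c : R) :
  continuous p -> T < c ->
  (forall n (s : R), is_derive s 1 (F n) (dF n s)) -> (forall n, continuous (dF n)) ->
  (forall n, F n 0 = 0) -> (forall n, F n T = 0) ->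
  Rintegrable D f -> Rintegrable D g ->
  (forall n, (\int[mu]_(s in D) ((F n s - f s) ^+ 2)%:E <= J n)%E) ->
  (forall n, (\int[mu]_(s in D) ((dF n s - g s) ^+ 2)%:E <= J' n)%E) ->
  J @ \oo --> (0%R%:E : \bar R) -> J' @ \oo --> (0%R%:E : \bar R) ->
  \int[mu]_(s in D) (p (c - s) * f s) =
  \int[mu]_(s in D) (primitive p (c - s) * g s).
Proof.
move=> cp Tc FdF cdF F0 FT fi gi FJ dFJ J0 J'0.
have cF n : continuous (F n).
  move=> s; apply: differentiable_continuous; apply/derivable1_diffP.
  by have [] := FdF n s.
have iF n : Rintegrable D (F n).
  by apply: Rintegrable_cont => //; exact: cont0T_continuous.
have idF n : Rintegrable D (dF n).
  by apply: Rintegrable_cont => //; exact: cont0T_continuous.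
have cP := cont0T_primitive p c cp Tc.
have cpr := cont0T_continuous T _ (continuous_reflect p c cp).
have lim1 := cvg_integral_L2 T T_gt0 _ f F J cpr fi iF FJ J0.
have lim2 := cvg_integral_L2 T T_gt0 _ g dF J' cP gi idF dFJ J'0.
apply: (cvg_unique (@norm_hausdorff R R^o) lim1).
apply: cvg_trans lim2; apply: near_eq_cvg; apply: nearW => n.
by apply/esym; exact: primitive_by_parts.
Qed.

(** By the mean value theorem the difference quotients of the primitive are
    values of [p], so they are uniformly bounded and converge pointwise;
    dominated convergence concludes. *)
Lemma cvg_difference_quotient p g (c : R) : continuous p -> T < c ->
  Rintegrable D g ->
  n.+1%:R * (\int[mu]_(s in D) (primitive p (c + n.+1%:R^-1 - s) * g s) -
             \int[mu]_(s in D) (primitive p (c - s) * g s)) @[n --> \oo] -->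
  \int[mu]_(s in D) (p (c - s) * g s).
Proof.
move=> cp Tc gi.
have cP n : cont0T T (fun s => primitive p (c + n.+1%:R^-1 - s)).
  by apply: cont0T_primitive => //; rewrite (lt_trans Tc)// ltrDl.
have cP0 := cont0T_primitive p c cp Tc.
have cpr := cont0T_continuous T _ (continuous_reflect p c cp).
have mv n s : 0 <= s <= T -> exists2 x, c - s <= x <= c - s + n.+1%:R^-1 &
    n.+1%:R * (primitive p (c + n.+1%:R^-1 - s) - primitive p (c - s)) = p x.
  move=> /andP[s0 sT].
  have cs : 0 < c - s by rewrite subr_gt0 (le_lt_trans sT).
  have le : c - s <= c - s + n.+1%:R^-1 by rewrite lerDl.
  have [||x xI E] := @MVT_segment R (primitive p) p _ _ le.
  - move=> x; rewrite in_itv/= => /andP[x0 _]; apply: is_derive_primitive => //.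
    exact: lt_trans x0.
  - apply: derivable_within_continuous => x; rewrite in_itv/= => /andP[x0 _].
    by have [] := is_derive_primitive p x cp (lt_le_trans cs x0).
  exists x; first by move: xI; rewrite in_itv.
  rewrite addrAC E [c - s + _]addrC addrK mulrCA divff ?mulr1//.
have [C C0 cC] : exists2 C : R, 0 <= C &
    forall x, 0 <= x <= c + 1 -> `|p x| <= C.
  have c1 : 0 < c + 1 by rewrite addr_gt0 ?ltr01// (lt_trans T_gt0).
  by apply: (cont0T_bounded _ c1); exact: cont0T_continuous.
pose q n s := n.+1%:R * (primitive p (c + n.+1%:R^-1 - s) - primitive p (c - s)).
have inv1 n : n.+1%:R^-1 <= 1 :> R by rewrite invf_le1// ler1n.
have qC n s : 0 <= s <= T -> `|q n s| <= C.
  move=> sT; rewrite /q; have [x /andP[x1 x2] ->] := mv n s sT.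
  apply: cC; move/andP: sT => [s0 sT]; have := inv1 n => n1.
  by apply/andP; split; [lra|rewrite (le_trans x2)// lerD// gerBl].
have cq n : cont0T T (q n).
  move=> s sT; apply: continuousM; first exact: cst_continuous.
  by apply: continuousB; [exact: (cP n)|exact: cP0].
have qE n : n.+1%:R * (\int[mu]_(s in D) (primitive p (c + n.+1%:R^-1 - s) * g s) -
             \int[mu]_(s in D) (primitive p (c - s) * g s)) =
    \int[mu]_(s in D) (q n s * g s).
  rewrite -RintegralB//; try exact: Rintegrable_mul.
  rewrite -RintegralZl//; last by apply: RintegrableB => //; exact: Rintegrable_mul.
  by apply: eq_Rintegral => s _; rewrite /q -mulrA mulrBl.
under eq_cvg do rewrite qE.
have gm : measurable_fun D g by move/integrableP : gi => [/measurable_EFinP].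
have [] := @dominated_convergence _ _ _ mu D mD
  (fun n s => (q n s * g s)%:E) (fun s => (p (c - s) * g s)%:E)
  (fun s => (C * `|g s|)%:E).
- move=> n; apply/measurable_EFinP; apply: measurable_funM => //.
  exact: cont0T_measurable.
- apply/measurable_EFinP; apply: measurable_funM => //.
  exact: cont0T_measurable.
- apply: aeW => s /mem_itv0T sT; apply: cvg_EFin; first exact: nearW.
  apply: cvgM; last exact: cvg_cst.
  apply/cvgrPdistC_lt => e e0.
  have /cvgrPdistC_lt/(_ e e0)/nbhs_ballP[d /= d0 dP] := cp (c - s).
  have [N _ /(_ N (leqnn N))/= Nd] := near_infty_natSinv_lt (PosNum d0).
  exists N => // n /= Nn; rewrite /q; have [x /andP[x1 x2] ->] := mv n s sT.
  apply: dP; rewrite /ball/= distrC ger0_norm ?subr_ge0//.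
  rewrite ltrBlDl (le_lt_trans x2)// ltrD2l (le_lt_trans _ Nd)//.
  by rewrite lef_pV2 ?posrE ?ltr0n// ler_nat ltnS.
- by apply: RintegrableZ => //; exact: Rintegrable_norm.
- apply: aeW => s n /mem_itv0T sT; rewrite /= lee_fin normrM ler_wpM2r//.
  exact: qC.
move=> ip _ h.
have : (\int[mu]_(s in D) (q n s * g s)%:E)%E @[n --> \oo] -->
    (\int[mu]_(s in D) (p (c - s) * g s))%:E.
  by rewrite /Rintegral fineK//; exact: (@integrable_fin_num _ _ _ mu D mD _ ip).
by move=> /fine_cvgP[].
Qed.

End DifferenceQuotient.

(** * Controls in the Sobolev space *)

Section ControlSpace.
Context {R : realType}.
Notation mu := (@lebesgue_measure R).
Variable T : R.
Hypothesis T_gt0 : 0 < T.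
Implicit Types (f g phi u : R -> R[i]).

Local Notation D := (`]0, T[%classic : set R).

Let mD : measurable D.
Proof. exact: measurable_itv. Qed.

Lemma L2_Rintegrable f : L2 T f ->
  Rintegrable D (fun s => re (f s)) /\ Rintegrable D (fun s => im (f s)).
Proof.
move=> [mr mi fi].
have sq (v : R -> R) : measurable_fun D v ->
    (forall s, v s ^+ 2 <= re (f s) ^+ 2 + im (f s) ^+ 2) -> Rintegrable D v.
  move=> mv vle; apply: (Rintegrable_sqr T T_gt0) => //; apply/integrableP; split.
    exact/measurable_EFinP/measurable_funX.
  apply: le_lt_trans fi; apply: ge0_le_integral_any => s _ //=.
  by rewrite lee_fin ger0_norm ?sqr_ge0.
by split; apply: sq => // s; rewrite ?lerDl ?lerDr sqr_ge0.
Qed.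

Lemma test_functionP phi : test_function T phi ->
  [/\ forall s : R, is_derive s 1 (fun x => re (phi x)) (re (cderiv phi s)),
      continuous (fun s => re (cderiv phi s)),
      forall s : R, is_derive s 1 (fun x => im (phi x)) (im (cderiv phi s)),
      continuous (fun s => im (cderiv phi s)) &
      phi 0 = 0 /\ phi T = 0].
Proof.
move=> [sm [a [b [a0 bT phi0]]]].
have dc (v : R -> R) : (forall s, derivable v s 1) -> continuous v.
  move=> dv s; apply: differentiable_continuous; exact/derivable1_diffP.
have dr (s : R) : derivable (fun x => re (phi x)) s 1 := (sm 0%N s).1.
have di (s : R) : derivable (fun x => im (phi x)) s 1 := (sm 0%N s).2.
have dr' (s : R) : derivable (derive1 (fun x => re (phi x))) s 1 := (sm 1%N s).1.
have di' (s : R) : derivable (derive1 (fun x => im (phi x))) s 1 := (sm 1%N s).2.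
split.
- move=> s; apply: (@DeriveDef _ _ _ _ _ _ _ (dr s)); exact/esym/derive1E.
- rewrite /cderiv.
  cbn beta iota.
  exact (dc _ dr').
- move=> s; apply: (@DeriveDef _ _ _ _ _ _ _ (di s)); exact/esym/derive1E.
- rewrite /cderiv.
  cbn beta iota.
  exact (dc _ di').
- by split; apply: phi0; rewrite in_itv/= negb_and -!ltNge ?a0 ?bT ?orbT.
Qed.

Lemma cintegralM phi u :
  cont0T T (fun s => re (phi s)) -> cont0T T (fun s => im (phi s)) ->
  Rintegrable D (fun s => re (u s)) -> Rintegrable D (fun s => im (u s)) ->
  cintegral D (fun s => phi s * u s) =
  (\int[mu]_(s in D) (re (phi s) * re (u s)) -
   \int[mu]_(s in D) (im (phi s) * im (u s))) +i*
  (\int[mu]_(s in D) (re (phi s) * im (u s)) +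
   \int[mu]_(s in D) (im (phi s) * re (u s))).
Proof.
move=> cr ci ur ui; rewrite /cintegral; congr (_ +i* _).
  rewrite -RintegralB//; try exact: Rintegrable_mul.
  by apply: eq_Rintegral => s _; case: (phi s) (u s) => a b [].
rewrite -RintegralD//; try exact: Rintegrable_mul.
by apply: eq_Rintegral => s _; case: (phi s) (u s) => a b [].
Qed.

(** Both components of a control are mean square limits of the corresponding
    components of test functions. *)
Lemma H10_by_parts f g (p : R -> R) (c : R) : H10_deriv T f g ->
  continuous p -> T < c ->
  \int[mu]_(s in D) (p (c - s) * re (f s)) =
    \int[mu]_(s in D) (primitive p (c - s) * re (g s)) /\
  \int[mu]_(s in D) (p (c - s) * im (f s)) =
    \int[mu]_(s in D) (primitive p (c - s) * im (g s)).
Proof.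
move=> [[Lf Lg _] [F [tF Ff dFg]]] cp Tc.
have [fr fi] := L2_Rintegrable f Lf; have [gr gi] := L2_Rintegrable g Lg.
have le (v w : R -> R[i]) :
    (\int[mu]_(s in D) ((re (v s) - re (w s)) ^+ 2)%:E <=
      sqnormL2 T (fun s => v s - w s)%R)%E /\
    (\int[mu]_(s in D) ((im (v s) - im (w s)) ^+ 2)%:E <=
      sqnormL2 T (fun s => v s - w s)%R)%E.
  by split; apply: ge0_le_integral_any => s _;
    rewrite lee_fin ?sqr_ge0// !raddfB/= ?lerDl ?lerDr sqr_ge0.
split.
  apply: (primitive_by_parts_weak T T_gt0 p _ _ (fun n s => re (F n s))
    (fun n s => re (cderiv (F n) s)) _ _ c cp Tc _ _ _ _ _ _ _ _ Ff dFg) => //.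
  - by move=> n s; have [h _ _ _ _] := test_functionP _ (tF n); exact: h.
  - by move=> n; have [_ h _ _ _] := test_functionP _ (tF n); exact: h.
  - by move=> n; have [_ _ _ _ [-> _]] := test_functionP _ (tF n).
  - by move=> n; have [_ _ _ _ [_ ->]] := test_functionP _ (tF n).
  - by move=> n; have [] := le (F n) f.
  - by move=> n; have [] := le (cderiv (F n)) g.
apply: (primitive_by_parts_weak T T_gt0 p _ _ (fun n s => im (F n s))
  (fun n s => im (cderiv (F n) s)) _ _ c cp Tc _ _ _ _ _ _ _ _ Ff dFg) => //.
- by move=> n s; have [_ _ h _ _] := test_functionP _ (tF n); exact: h.
- by move=> n; have [_ _ _ h _] := test_functionP _ (tF n); exact: h.
- by move=> n; have [_ _ _ _ [-> _]] := test_functionP _ (tF n).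
- by move=> n; have [_ _ _ _ [_ ->]] := test_functionP _ (tF n).
- by move=> n; have [] := le (F n) f.
- by move=> n; have [] := le (cderiv (F n)) g.
Qed.

(** A translation of the kernel differentiates, under the integral, into a
    derivative of the control. *)
Lemma H10_difference_quotient f g (rho : R -> R[i]) (c : R) : H10_deriv T f g ->
  continuous (fun s => re (rho s)) -> continuous (fun s => im (rho s)) -> T < c ->
  (n.+1%:R * (re (cintegral D (fun s => rho (c + n.+1%:R^-1 - s) * f s)) -
             re (cintegral D (fun s => rho (c - s) * f s))) @[n --> \oo] -->
    re (cintegral D (fun s => rho (c - s) * g s))) /\
  (n.+1%:R * (im (cintegral D (fun s => rho (c + n.+1%:R^-1 - s) * f s)) -
             im (cintegral D (fun s => rho (c - s) * f s))) @[n --> \oo] -->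
    im (cintegral D (fun s => rho (c - s) * g s))).
Proof.
move=> fg cr ci Tc; have [[Lf Lg _] _] := fg.
have [fr fi] := L2_Rintegrable f Lf; have [gr gi] := L2_Rintegrable g Lg.
have c0r x := cont0T_continuous T _ (continuous_reflect _ x cr).
have c0i x := cont0T_continuous T _ (continuous_reflect _ x ci).
have Tcn n : T < c + n.+1%:R^-1 by rewrite (lt_trans Tc)// ltrDl.
rewrite (cintegralM (fun s => rho (c - s)) g)//.
have fE x : T < x -> cintegral D (fun s => rho (x - s) * f s) =
  (\int[mu]_(s in D) (primitive (fun v => re (rho v)) (x - s) * re (g s)) -
   \int[mu]_(s in D) (primitive (fun v => im (rho v)) (x - s) * im (g s))) +i*
  (\int[mu]_(s in D) (primitive (fun v => re (rho v)) (x - s) * im (g s)) +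
   \int[mu]_(s in D) (primitive (fun v => im (rho v)) (x - s) * re (g s))).
  move=> Tx; rewrite (@cintegralM (fun s => rho (x - s)) f)//.
  have [E1 E2] := H10_by_parts f g _ x fg cr Tx.
  have [E3 E4] := H10_by_parts f g _ x fg ci Tx.
  by rewrite E1 E2 E3 E4.
under eq_cvg do rewrite (fE _ (Tcn _)) (fE _ Tc)/= opprD opprK addrACA mulrDr.
under [in X in _ /\ X]eq_cvg do
  rewrite (fE _ (Tcn _)) (fE _ Tc)/= opprD addrACA mulrDr.
have q1 := cvg_difference_quotient T T_gt0 _ _ c cr Tc gr.
have q2 := cvg_difference_quotient T T_gt0 _ _ c ci Tc gi.
have q3 := cvg_difference_quotient T T_gt0 _ _ c cr Tc gi.
have q4 := cvg_difference_quotient T T_gt0 _ _ c ci Tc gr.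
split; last exact: cvgD q3 q4.
apply: cvgD; first exact: q1.
under eq_cvg do rewrite [- _ + _]addrC -opprB mulrN.
exact: cvgN q2.
Qed.

End ControlSpace.

(** * The pencil on steering controls *)

Section Pencil.
Context {R : realType} {H : completeNormedModType R[i]}.
Notation mu := (@lebesgue_measure R).
Variable ip : {dot H for Num.conj}.
Hypothesis ip_norm : hilbert_norm ip.
Variables (T : R) (T_gt0 : 0 < T).
Variable S : R -> H -> H.
Hypothesis S_C0 : C0_semigroup S.
Variable b : H.
Implicit Types (f g : R -> R[i]) (d y : H).

Local Notation D := (`]0, T[%classic : set R).

Let mD : measurable D.
Proof. exact: measurable_itv. Qed.

Lemma orbit_Rintegrable f d (c : R) : L2 T f ->
  Rintegrable D (fun s => re (orbit_ip ip S b d (c - s) * f s)) /\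
  Rintegrable D (fun s => im (orbit_ip ip S b d (c - s) * f s)).
Proof.
move=> Lf; have [fr fi] := L2_Rintegrable T T_gt0 f Lf.
have [cr ci] := orbit_ip_continuous ip ip_norm S S_C0 b d.
have cr0 := cont0T_continuous T _ (continuous_reflect _ c cr).
have ci0 := cont0T_continuous T _ (continuous_reflect _ c ci).
split.
  apply: (Rintegrable_ext D (fun s => re (orbit_ip ip S b d (c - s)) * re (f s) -
    im (orbit_ip ip S b d (c - s)) * im (f s))) => //.
    by move=> s _; case: (orbit_ip _ _ _ _ _) (f s) => p q [].
  by apply: RintegrableB => //; exact: Rintegrable_mul.
apply: (Rintegrable_ext D (fun s => re (orbit_ip ip S b d (c - s)) * im (f s) +
  im (orbit_ip ip S b d (c - s)) * re (f s))) => //.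
  by move=> s _; case: (orbit_ip _ _ _ _ _) (f s) => p q [].
by apply: RintegrableD => //; exact: Rintegrable_mul.
Qed.

(** Apply [<S h _, d>] to the Bochner integral of [f s *: S (T - s) b] that
    defines the final state. *)
Lemma steered_pairing f d y (h : R) : L2 T f -> steers S b T f y -> 0 <= h ->
  cintegral D (fun s => orbit_ip ip S b d (T + h - s) * f s) = ip (S h y) d.
Proof.
move=> Lf [x [xP <-]] h0.
have [+ _ _ _] := S_C0 => /(_ h h0) bS.
have [mr mi] := ip_functional ip ip_norm (S h) d bS.
have [ir ii] := orbit_Rintegrable f d (T + h) Lf.
have bI := xP T; rewrite lexx (ltW T_gt0)/= in bI; have {}bI := bI isT.
have E s : D s -> ip (S h (f s *: S (T - s) b)) d =
    orbit_ip ip S b d (T + h - s) * f s.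
  rewrite /= in_itv/= => /andP[s0 sT]; have Ts : 0 <= T - s by rewrite subr_ge0 ltW.
  rewrite semigroupZ// ipZl mulrC -semigroupM// /orbit_ip.
  have -> : T + h - s = h + (T - s) by rewrite [T + h]addrC addrA.
  by rewrite max_l// addr_ge0.
have Er : {in D, (fun s => re (orbit_ip ip S b d (T + h - s) * f s)) =1
    (fun s => re (ip (S h (f s *: S (T - s) b)) d))}.
  by move=> s /[1!inE] sD /=; rewrite E.
have Ei : {in D, (fun s => im (orbit_ip ip S b d (T + h - s) * f s)) =1
    (fun s => im (ip (S h (f s *: S (T - s) b)) d))}.
  by move=> s /[1!inE] sD /=; rewrite E.
have br := bochner_functional _ D _ _ mr mD bI (Rintegrable_ext _ _ _ mD Er ir).
have bi := bochner_functional _ D _ _ mi mD bI (Rintegrable_ext _ _ _ mD Ei ii).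
rewrite /cintegral.
have -> : \int[mu]_(s in D) re (orbit_ip ip S b d (T + h - s) * f s) =
    re (ip (S h (x T)) d) by rewrite -br; exact: eq_Rintegral.
have -> : \int[mu]_(s in D) im (orbit_ip ip S b d (T + h - s) * f s) =
    im (ip (S h (x T)) d) by rewrite -bi; exact: eq_Rintegral.
by case: (ip _ _).
Qed.

(** With [h = 0] and [d = y] the pairing is [|y|^2], which would be the integral
    of an almost everywhere zero function. *)
Lemma steers_neq0 f y : L2 T f -> steers S b T f y -> y != 0 -> ~ ae_zero T f.
Proof.
move=> Lf st y0 f0.
have := steered_pairing f y y 0 Lf st (lexx 0).
rewrite addr0 semigroup0//.
have [ir ii] := orbit_Rintegrable f y T Lf.
have z (v : R -> R) : Rintegrable D v ->
    (forall s, f s = 0 -> v s = 0) -> \int[mu]_(s in D) v s = 0.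
  move=> iv v0; rewrite /Rintegral.
  rewrite (_ : (\int[mu]_(s in D) (v s)%:E)%E = 0%E)//.
  rewrite (@ae_eq_integral _ _ _ mu D (cst 0%E) (fun s => (v s)%:E))//.
  - by rewrite integral0.
  - by case/integrableP : iv.
  - case: f0 => N [mN N0 fN]; exists N; split => // s /= nv; apply: fN => /= f0s.
    by apply: nv; rewrite in_itv/= => sT; rewrite v0// f0s.
rewrite /cintegral !z//; last 2 first.
- by move=> s ->; rewrite mulr0.
- by move=> s ->; rewrite mulr0.
move=> /(congr1 (@complex.Re R))/=; rewrite rnorm_ip// => /esym/eqP.
by rewrite sqrf_eq0 => /eqP/rnorm_eq0/eqP; exact/negP.
Qed.

(** Differentiate [steered_pairing] at [h] from the right, along the steps
    [1 / (n + 1)]. *)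
Lemma steered_dpairing f g d y y' (h : R) : H10_deriv T f g ->
  steers S b T f y -> generator S (y, y') -> 0 < h ->
  cintegral D (fun s => orbit_ip ip S b d (T + h - s) * g s) = ip (S h y') d.
Proof.
move=> fg st Ay h0; have [[Lf _ _] _] := fg.
have [cr ci] := orbit_ip_continuous ip ip_norm S S_C0 b d.
have Th : T < T + h by rewrite ltrDl.
have [qr qi] := H10_difference_quotient T T_gt0 f g _ _ fg cr ci Th.
have hn n : 0 <= h + n.+1%:R^-1 by rewrite addr_ge0// ltW.
have E0 : cintegral D (fun s => orbit_ip ip S b d (T + h - s) * f s) =
    ip (S h y) d by apply: steered_pairing => //; exact: ltW.
have En n : cintegral D (fun s => orbit_ip ip S b d (T + h + n.+1%:R^-1 - s) * f s) =
    ip (S h (S n.+1%:R^-1 y)) d.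
  by rewrite -semigroupM// ?(ltW h0)// -addrA; apply: steered_pairing.
have lim (m : H -> R) : bounded_functional m ->
    n.+1%:R * (m (S n.+1%:R^-1 y) - m y) @[n --> \oo] --> m y'.
  move=> bm; have [mD_ mZ [C C0 mC]] := bm.
  apply/cvgrPdistC_lt => e e0.
  have e'0 : 0 < e / (C + 1) by rewrite divr_gt0// ltr_wpDl.
  have [dl dl0 dlP] := generator_near0 S S_C0 _ _ _ Ay e'0.
  have [N _ /(_ N (leqnn N))/= Nd] := near_infty_natSinv_lt (PosNum dl0).
  exists N => // n /= Nn.
  have n0 : n.+1%:R != 0 :> R by rewrite pnatr_eq0.
  rewrite -functionalB// -mZ -functionalB//.
  rewrite (le_lt_trans (mC _))//.
  have -> : n.+1%:R%:C *: (S n.+1%:R^-1 y - y) - y' =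
      n.+1%:R%:C *: (S n.+1%:R^-1 y - y - (n.+1%:R^-1)%:C *: y').
    by rewrite [RHS]scalerBr scalerA -rmorphM/= divff// scale1r.
  rewrite rnormZ ger0_norm//.
  have : rnorm (S n.+1%:R^-1 y - y - (n.+1%:R^-1)%:C *: y') <=
      e / (C + 1) * n.+1%:R^-1.
    apply: dlP; rewrite invr_ge0 ler0n/= (le_lt_trans _ Nd)//.
    by rewrite lef_pV2 ?posrE ?ltr0n// ler_nat ltnS.
  rewrite ler_pdivlMr ?ltr0n// mulrC => le.
  apply: (@le_lt_trans _ _ (C * (e / (C + 1)))); first by rewrite ler_wpM2l.
  by rewrite mulrCA gtr_pMr// ltr_pdivrMr ?mul1r ?ltrDl ?ltr_wpDl.
have [+ _ _ _] := S_C0 => /(_ h (ltW h0)) bS.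
have [mr mi] := ip_functional ip ip_norm (S h) d bS.
have uniq (u : nat -> R) (a a' : R) : u @ \oo --> a -> u @ \oo --> a' -> a = a'.
  by apply: (@cvg_unique R^o); exact: norm_hausdorff.
apply/eqP; rewrite eq_complex; apply/andP; split; apply/eqP.
  apply: uniq qr _; under eq_cvg do rewrite En E0.
  exact: lim _ mr.
apply: uniq qi _; under eq_cvg do rewrite En E0.
exact: lim _ mi.
Qed.

End Pencil.

Section Assembly.
Context {R : realType} {H : completeNormedModType R[i]}.
Variables (T : R) (T_gt0 : 0 < T).

Lemma eq_cintegral (D : set R) (u v : R -> R[i]) : (forall s, D s -> u s = v s) ->
  cintegral D u = cintegral D v.
Proof.
move=> uv; rewrite /cintegral.
by congr (_ +i* _); apply: eq_Rintegral => s /[1!inE] /uv ->.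
Qed.

Lemma wderivP (f : R -> R[i]) : H10 T f -> H10_deriv T f (wderiv T f).
Proof. by move=> [g fg]; exact: (xgetPex (fun=> 0) (ex_intro _ g fg)). Qed.

Variable ip : {dot H for Num.conj}.
Hypothesis ip_norm : hilbert_norm ip.
Variable S : R -> H -> H.
Hypothesis S_C0 : C0_semigroup S.
Variables (b d : H) (r : R -> R[i]).
Hypothesis rE : forall t, 0 <= t -> r t = ip (S t b) d.

Lemma pairing_steers (f : R -> R[i]) (y : H) (t : R) : H10 T f ->
  steers S b T f y -> 0 < t < T ->
  conv_pairing T r t f = ip (S (T - t) y) d.
Proof.
move=> [g [[Lf _ _] _]] st /andP[t0 tT].
have Tt : 0 <= T - t by rewrite subr_ge0 ltW.
rewrite -(steered_pairing ip ip_norm T T_gt0 S S_C0 b f d y _ Lf st Tt).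
apply: eq_cintegral => s /=; rewrite in_itv/= => /andP[s0 sT].
rewrite (_ : T + (T - t) - s = 2 * T - t - s); last by ring.
(* The argument is positive, so rho is the response there. *)
by rewrite rE /orbit_ip ?max_l//; lra.
Qed.

Lemma dpairing_steers (f : R -> R[i]) (y y' : H) (t : R) : H10 T f ->
  steers S b T f y -> generator S (y, y') -> 0 < t < T ->
  dconv_pairing T r t f = ip (S (T - t) y') d.
Proof.
move=> fH st Ay /andP[t0 tT].
have Tt : 0 < T - t by rewrite subr_gt0.
rewrite /dconv_pairing /dist_deriv opprK.
rewrite -(steered_dpairing ip ip_norm T T_gt0 S S_C0 b f _ d y y' _ (wderivP f fH) st Ay Tt).
apply: eq_cintegral => s /=; rewrite in_itv/= => /andP[s0 sT].
rewrite (_ : T + (T - t) - s = 2 * T - t - s); last by ring.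
(* The argument is positive, so rho is the response there. *)
by rewrite rE /orbit_ip ?max_l//; lra.
Qed.

(** In terms of the final states, the pencil is the operator [A - z]. *)
Lemma pencil_steers (f : R -> R[i]) (y y' : H) (z : R[i]) (t : R) : H10 T f ->
  steers S b T f y -> generator S (y, z *: y + y') -> 0 < t < T ->
  pencil T r z f t = ip (S (T - t) y') d.
Proof.
move=> fH st Ay tT; rewrite /pencil (dpairing_steers f y (z *: y + y'))//.
rewrite (pairing_steers f y)//; move/andP: tT => [t0 tT].
have Tt : 0 <= T - t by rewrite subr_ge0 ltW.
rewrite semigroupD// semigroupZ// linearDl/= ipZl.
by rewrite addrC addKr.
Qed.
End Assembly.

Theorem mainTheorem1 (R : realType) (H : completeNormedModType R[i])
  (ip : {dot H for Num.conj}) (ip_norm : hilbert_norm ip)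
  (T : R) (T_gt0 : 0 < T)
  (S : R -> H -> H) (S_C0 : C0_semigroup S)
  (A : set (H * H)) (A_gen : A = generator S)
  (lam : nat -> R[i]) (lam_inj : injective lam)
  (A_spectrum : spectrum A = range lam)
  (L : nat -> nat) (L_gt0 : forall k, (0 < L k)%N)
  (phi psi : nat -> nat -> H)
  (phi_chain : forall k, jordan_chain A (lam k) (L k) (phi k))
  (phi_mult : forall k, root_space A (lam k) =
    [set x | exists c : nat -> R[i], x = \sum_(i < L k) c i *: phi k i])
  (phi_riesz : riesz_basis ip (@root_family R H L phi))
  (psi_riesz : riesz_basis ip (@root_family R H L psi))
  (psi_root : forall k i, (i < L k)%N -> root_vector (adjoint ip A) (psi k i))
  (phi_psi : biorthogonal ip L phi psi)
  (b d : H) (bc dc : nat -> nat -> R[i])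
  (b_exp : expansion L phi b bc) (d_exp : expansion L psi d dc)
  (Hctrl : spectrally_controllable S b T L phi)
  (f : nat -> nat -> R -> R[i])
  (f_H10 : forall k i, (i < L k)%N -> H10 T (f k i))
  (f_steers : forall k i, (i < L k)%N -> steers S b T (f k i) (phi k i)) :
  forall k, pencil_root_chain T (response lam L bc dc) (lam k) (L k) (f k).
Proof.
rewrite A_gen in phi_chain.
have rE t : 0 <= t -> response lam L bc dc t = ip (S t b) d.
  exact: (response_orbit ip ip_norm S S_C0 lam L phi psi).
move=> k; have [phi0 phiS] := phi_chain k.
have chain i y' t : (i < L k)%N -> generator S (phi k i, lam k *: phi k i + y') ->
    0 < t < T -> pencil T (response lam L bc dc) (lam k) (f k i) t =
      ip (S (T - t) y') d.
  move=> iL Aphi tT; apply: (pencil_steers T T_gt0 ip ip_norm S S_C0 b d _ rE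
    (f k i) (phi k i)) => //; [exact: f_H10|exact: f_steers].
split.
- move=> i iL; have [g [[Lf _ _] _]] := f_H10 k i iL.
  apply: (steers_neq0 ip ip_norm T T_gt0 S S_C0 b (f k i) (phi k i) Lf (f_steers k i iL)).
  apply/eqP => phi_eq0.
  have := phi_psi (Tagged (fun k => 'I_(L k)) (Ordinal iL))
    (Tagged (fun k => 'I_(L k)) (Ordinal iL)).
  rewrite /root_family/= phi_eq0 linear0l eqxx => /eqP.
  by rewrite eq_sym oner_eq0.
- move=> t tT; rewrite (chain 0%N 0)//; last by rewrite addr0.
  rewrite semigroup_at0// ?linear0l// subr_ge0 ltW//.
  by case/andP: tT.
- move=> i iL t tT; rewrite (chain _ _ _ iL (phiS i iL) tT).
  rewrite (pairing_steers T T_gt0 ip ip_norm S S_C0 b d _ rE (f k i) (phi k i))//.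
  + exact: subrr.
  + exact: f_H10 (ltnW iL).
  + exact: f_steers (ltnW iL).
Qed.
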